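(* Let $d_1\ge1$, $d_2\ge2$, write $(x,y)=(x,y_1,y')\in\mathbb{R}^{d_1}\times\mathbb{R}\times\mathbb{R}^{d_2-1}$, let $0<\varepsilon\le1$ and define the ellipsoid $$Z_\varepsilon=\Bigl\{(x,y):\ y_1=0,\ |x|^2+\frac{|y'|^2}{\varepsilon^2}<1\Bigr\}$$ in the Cauchy hypersurface $\{y_1=0\}$. If $u$ is a $C^2$ solution of $\Delta_xu-\Delta_yu=\sum_{j=1}^{d_1}\partial_{x_j}^2u-\sum_{j=1}^{d_2}\partial_{y_j}^2u=0$ whose Cauchy data $u(x,0,y')$, $\partial_{y_1}u(x,0,y')$ vanish on $Z_\varepsilon$, then $u$ vanishes on $$D=\{(x,y)\in\mathbb{R}^{d_1+d_2}:\ |x|+|y|<1\},$$ and in particular its Cauchy data, along with all their derivatives, vanish on $\{(x,y')\ :\ y_1=0,\ |x|+|y'|<1\}$. *)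

(* Defs.v *)
(* Points of R^(d1+d2) are row vectors
   p : 'rV[R]_(d1+d2); coordinates k < d1 are the x-variables,
   coordinate k = d1 is y_1, coordinates d1 < k are y'. *)
From HB Require Import structures.
From mathcomp Require Import all_boot all_order all_algebra.
From mathcomp Require Import all_classical all_reals all_analysis.
Set Implicit Arguments. Unset Strict Implicit. Unset Printing Implicit Defensive.
Import Order.TTheory GRing.Theory Num.Theory.
Import numFieldNormedType.Exports.
Local Open Scope ring_scope.

Section Defs.
Variable R : realType.

Definition basisv (n : nat) (k : 'I_n) : 'rV[R]_n := delta_mx 0 k.

Definition pderiv (n : nat) (k : 'I_n) (f : 'rV[R]_n -> R) : 'rV[R]_n -> R :=
  fun p => 'D_(basisv k) f p.

Definition C2 (n : nat) (f : 'rV[R]_n -> R) : Prop :=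
  continuous f /\
  forall i : 'I_n,
    (forall p, derivable f p (basisv i)) /\ continuous (pderiv i f) /\
    forall j : 'I_n,
      (forall p, derivable (pderiv i f) p (basisv j)) /\
      continuous (pderiv j (pderiv i f)).

Definition wave_op (d1 d2 : nat) (u : 'rV[R]_(d1 + d2) -> R) (p : 'rV[R]_(d1 + d2)) : R :=
  \sum_(k < d1 + d2 | (k < d1)%N) pderiv k (pderiv k u) p
  - \sum_(k < d1 + d2 | (d1 <= k)%N) pderiv k (pderiv k u) p.

Definition sqx (d1 d2 : nat) (p : 'rV[R]_(d1 + d2)) : R :=
  \sum_(k < d1 + d2 | (k < d1)%N) p 0 k ^+ 2.
Definition sqy (d1 d2 : nat) (p : 'rV[R]_(d1 + d2)) : R :=
  \sum_(k < d1 + d2 | (d1 <= k)%N) p 0 k ^+ 2.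
Definition sqy' (d1 d2 : nat) (p : 'rV[R]_(d1 + d2)) : R :=
  \sum_(k < d1 + d2 | (d1 < k)%N) p 0 k ^+ 2.

Definition on_y1_0 (d1 d2 : nat) (p : 'rV[R]_(d1 + d2)) : Prop :=
  forall k : 'I_(d1 + d2), (k : nat) = d1 -> p 0 k = 0.

Definition Zeps (d1 d2 : nat) (eps : R) (p : 'rV[R]_(d1 + d2)) : Prop :=
  on_y1_0 p /\ sqx p + sqy' p / eps ^+ 2 < 1.

Definition Ddom (d1 d2 : nat) (p : 'rV[R]_(d1 + d2)) : Prop :=
  Num.sqrt (sqx p) + Num.sqrt (sqy p) < 1.

Definition Dslice (d1 d2 : nat) (p : 'rV[R]_(d1 + d2)) : Prop :=
  on_y1_0 p /\ Num.sqrt (sqx p) + Num.sqrt (sqy' p) < 1.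

End Defs.

(* Main.v *)
(** Idea.  Fix x and a centre y0 in the hyperplane y_1 = 0, close to 0, and put
    h(x, s) = int u(x, y0 + s z) (1 - |z|^2)_+^m dz.  Averaging with this weight
    turns Delta_x u = Delta_y u into the damped wave equation
    h_ss + (b / s) h_s = Delta_x h with b = 2m + 1 + d2 >= 0 (an Asgeirsson mean:
    the weight is the projection of a sphere of dimension d2 + 2m + 1).  Since u
    and its y-derivatives vanish at (x, y0) for (x, y0) in Z_eps, h and its first
    derivatives vanish at s = 0, and because the damping has the good sign an
    energy estimate in the backward cone |x - x0| + s < rho gives h = 0 there,
    up to the singular time s = 0; no unique continuation theorem is needed.
    The mean with the extra weight z_1 vanishes likewise, by the same
    argument applied to the means of the derivative of u in y_1.

    Differentiating these identities in the centre y0 along the hyperplane and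
    integrating by parts multiplies the density by y_j, j > 1, while y_1^2 is
    recovered from |z|^2.  So u(x0, .) has vanishing moments against every
    polynomial, and testing with large powers of a concave paraboloid peaked at
    y* gives u(x0, y* ) = 0 whenever |x0| + |y*| < 1. *)

Require Import Defs.
From HB Require Import structures.
From mathcomp Require Import all_boot all_order all_algebra.
From mathcomp Require Import all_classical all_reals all_analysis.
From mathcomp Require Import ring lra.
Set Implicit Arguments. Unset Strict Implicit. Unset Printing Implicit Defensive.
Import Order.TTheory GRing.Theory Num.Theory.
Import numFieldNormedType.Exports.
Local Open Scope classical_set_scope.
Local Open Scope ring_scope.

(** * Continuity and one-variable derivatives *)

(** Since [u] is only C^2, its derivative in y_1 is only C^1 and need not be a classical solution.
    Its means are therefore differentiated twice only through means of [u] itself, which brings in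
    negative powers of s; this is why [energy] asks for continuity up to s = 0 of first derivatives
    and for s > 0 of second ones. Differentiation along the hyperplane never produces a factor y_1,
    so moments with an odd power of y_1 need the odd mean as a separate input. Its initial data
    involve the second y_1-derivative of [u] on Z_eps, which the equation expresses through
    tangential derivatives. The cone radius rho lies between |y*| and 1 - |x0| and is chosen
    independently of the centre; eps only limits how far centres may move from 0. A small open set
    of centres suffices for differentiation, hence D does not depend on eps. Every integral runs
    over a fixed cube: the kernels and the cone cutoff vanish on its faces, which replaces boundary
    terms and moving domains. *)

Section Cts.
Variables (R : realType) (T : topologicalType).
Implicit Types (f g : T -> R) (a : T).

Definition cts f a := f b @[b --> a] --> f a.

Lemma cts_cst (c : R) a : cts (fun=> c) a.
Proof. exact: cvg_cst. Qed.

Lemma ctsD f g a : cts f a -> cts g a -> cts (fun b => f b + g b) a.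
Proof. exact: cvgD. Qed.

Lemma ctsN f a : cts f a -> cts (fun b => - f b) a.
Proof. exact: cvgN. Qed.

Lemma ctsB f g a : cts f a -> cts g a -> cts (fun b => f b - g b) a.
Proof. exact: cvgB. Qed.

Lemma ctsM f g a : cts f a -> cts g a -> cts (fun b => f b * g b) a.
Proof. exact: cvgM. Qed.

Lemma ctsV f a : f a != 0 -> cts f a -> cts (fun b => (f b)^-1) a.
Proof. exact: cvgV. Qed.

Lemma ctsX f n a : cts f a -> cts (fun b => f b ^+ n) a.
Proof.
move=> cf; elim: n => [|n ih]; first exact: cts_cst.
under [X in cts X]eq_fun do rewrite exprS.
exact: ctsM.
Qed.

Lemma cts_sum (I : Type) (r : seq I) (P : pred I) (F : I -> T -> R) a :
  (forall i, cts (F i) a) -> cts (fun b => \sum_(i <- r | P i) F i b) a.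
Proof.
move=> cF; elim: r => [|i r ih].
  by under [X in cts X]eq_fun do rewrite big_nil; exact: cts_cst.
under [X in cts X]eq_fun do rewrite big_cons.
by case: (P i) => //; apply: ctsD.
Qed.

Lemma cts_max f g a : cts f a -> cts g a -> cts (fun b => Num.max (f b) (g b)) a.
Proof.
by move=> cf cg; exact: (@continuous_max R T f g a cf cg).
Qed.

Lemma cts_row n (h : T -> 'rV[R]_n) a :
  (forall k, cts (fun b => h b 0 k) a) -> h b @[b --> a] --> h a.
Proof.
move=> ch; apply/cvg_ballP => e e0.
have : \forall b \near a, forall k, ball (h a 0 k) e (h b 0 k).
  by apply: filter_forall => k; exact: (cvg_ball (ch k)).
by apply: filterS => b hb; split => // i k; rewrite (ord1 i).
Qed.

End Cts.

Lemma cts_comp (R : realType) (T U : topologicalType) (f : U -> R) (h : T -> U) a :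
  cts f (h a) -> h b @[b --> a] --> h a -> cts (fun b => f (h b)) a.
Proof. by move=> cf ch; exact: (continuous_comp ch cf). Qed.

Lemma cts_coord (R : realType) n (k : 'I_n) (p : 'rV[R]_n) : cts (fun q : 'rV[R]_n => q 0 k) p.
Proof. exact: coord_continuous. Qed.

Lemma cvg_pairT (T U V : topologicalType) (f : T -> U) (g : T -> V) a :
  f b @[b --> a] --> f a -> g b @[b --> a] --> g a ->
  (f b, g b) @[b --> a] --> (f a, g a).
Proof. exact: cvg_pair. Qed.

Lemma cvgT_cst (T U : topologicalType) (x : U) (a : T) :
  (fun=> x) b @[b --> a] --> (fun=> x) a.
Proof. exact: (@cvg_cst U x T). Qed.

Section Der.
Variable R : realType.
Implicit Types (f g : R -> R) (t l : R).

Definition der f t l := is_derive t (1 : R) f l.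

(** Serves where a derivative comes from an estimate of difference quotients rather than from
    calculus rules: additivity in the direction, differentiation under the integral, truncated
    powers at 0. *)
Lemma derP f t l : der f t l <->
  forall e, 0 < e -> exists2 d, 0 < d &
    forall h, h != 0 -> `|h| < d -> `|h^-1 * (f (t + h) - f t) - l| < e.
Proof.
split=> [[df <-] e e0|H].
  have /cvgrPdist_lt /(_ e e0) /= := df.
  rewrite -/(derive f t 1) => /nbhs_ballP [d /= d0 hd].
  exists d => // h h0 hlt; rewrite distrC.
  have := hd h; rewrite /ball /= sub0r normrN => /(_ hlt h0).
  by rewrite /= [h *: 1]mulr1 [h + t]addrC.
have cl : h^-1 *: ((f \o shift t) (h *: (1:R)) - f t) @[h --> 0^'] --> l.
  apply/cvgrPdist_lt => e e0; have [d d0 hd] := H e e0.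
  apply/nbhs_ballP; exists d => //= h; rewrite /ball /= sub0r normrN => hlt h0.
  by rewrite distrC [h *: 1]mulr1 [h + t]addrC; exact: hd.
by split; [apply/cvg_ex; exists l|exact: cvg_lim cl].
Qed.

Lemma der_cst c t : der (fun=> c) t 0.
Proof. exact: is_derive_cst. Qed.

Lemma der_id t : der id t 1.
Proof. exact: is_derive_id. Qed.

Lemma derD f g t l m : der f t l -> der g t m -> der (fun s => f s + g s) t (l + m).
Proof. exact: is_deriveD. Qed.

Lemma derB f g t l m : der f t l -> der g t m -> der (fun s => f s - g s) t (l - m).
Proof. exact: is_deriveB. Qed.

Lemma derM f g t l m : der f t l -> der g t m ->
  der (fun s => f s * g s) t (l * g t + f t * m).
Proof.
move=> df dg; have := @is_deriveM _ _ f g t 1 l m df dg.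
by move/is_derive_eq; apply; rewrite addrC [l * _]mulrC.
Qed.

Lemma der_eq f t l m : der f t l -> l = m -> der f t m.
Proof. by move=> df <-. Qed.

Lemma der_uniq f t l m : der f t l -> der f t m -> l = m.
Proof. by move=> [_ <-] [_ <-]. Qed.

Lemma der_sum (I : Type) (r : seq I) (P : pred I) (F : I -> R -> R) (L : I -> R) t :
  (forall i, der (F i) t (L i)) ->
  der (fun s => \sum_(i <- r | P i) F i s) t (\sum_(i <- r | P i) L i).
Proof.
move=> dF; elim: r => [|i r ih].
  by under [X in der X]eq_fun do rewrite big_nil; rewrite big_nil; exact: der_cst.
under [X in der X]eq_fun do rewrite big_cons.
by rewrite big_cons; case: (P i) => //; exact: derD.
Qed.

Lemma der_comp f g t l m : der g t m -> der f (g t) l -> der (fun s => f (g s)) t (l * m).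
Proof.
move=> dg df; have := @is_derive1_comp _ f g t l m df dg.
by move/is_derive_eq; apply; rewrite mulrC.
Qed.

Lemma derXn f n t l : der f t l -> der (fun s => f s ^+ n.+1) t (n.+1%:R * f t ^+ n * l).
Proof.
move=> df; elim: n => [|n ih].
  under [X in der X]eq_fun do rewrite expr1.
  by rewrite expr0 !mul1r.
under [X in der X]eq_fun do rewrite exprS.
apply: (der_eq (derM df ih)).
by rewrite -[n.+2%:R]natr1 exprS; ring.
Qed.

Lemma der_cts f t l : der f t l -> cts f t.
Proof. by move=> [df _]; move/derivable1_diffP: df => /differentiable_continuous. Qed.

Lemma der_near f g t l : (\forall s \near t, f s = g s) -> der f t l -> der g t l.
Proof. by move=> h; apply: near_eq_is_derive. Qed.

Lemma der_MVT f (df : R -> R) a b : a < b ->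
  (forall t, a <= t <= b -> cts f t) ->
  (forall t, a < t < b -> der f t (df t)) ->
  exists2 c, a < c < b & f b - f a = df c * (b - a).
Proof.
move=> ab cf hf; have [] := @MVT R f df a b ab.
- by move=> x; rewrite in_itv /= => /hf.
- apply: continuous_in_subspaceT => x; rewrite inE /= in_itv /=; exact: cf.
by move=> c; rewrite in_itv /= => hc E; exists c.
Qed.

Lemma der0_cst f a b : a <= b ->
  (forall t, a <= t <= b -> der f t 0) -> f a = f b.
Proof.
rewrite le_eqVlt => /orP[/eqP->//|ab] hf.
have [] := @der_MVT f (fun=> 0) a b ab.
- by move=> t /hf /der_cts.
- by move=> t /andP[? ?]; apply: hf; rewrite !ltW.
by move=> c _; rewrite mul0r => /eqP; rewrite subr_eq0 => /eqP.
Qed.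

(** Lebesgue integration enters here only; all later integrals are differences of primitives. *)
Lemma antiderivative f (a b : R) : a < b -> (forall t, cts f t) ->
  exists F : R -> R, forall t, a < t < b -> der F t (f t).
Proof.
move=> ab cf; pose mu := @lebesgue_measure R.
have fi : mu.-integrable `[a, b] (EFin \o f).
  apply: continuous_compact_integrable; first exact: segment_compact.
  by apply: continuous_subspaceT => x; exact: cf.
exists (fun x => \int[mu]_(s in `[a, x]) f s)%R => t /andP[at_ tb].
have [dF FE] := continuous_FTC1_closed tb fi at_ (cf t).
by split; rewrite -?derive1E.
Qed.

Lemma derV t : t != 0 -> der (fun s => s^-1) t (- t ^- 2).
Proof.
move=> t0; have := @is_deriveV R id t 1 1 t0 (is_derive_id t 1).
by move/is_derive_eq; apply; rewrite [_ *: _]mulr1.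
Qed.

Lemma der_pos f g t l : 0 < t -> (forall s, 0 < s -> f s = g s) -> der f t l -> der g t l.
Proof.
by move=> t0 fg; apply: der_near; have := lt_nbhsr t0; apply: filterS => s; exact: fg.
Qed.

End Der.

(** * Iterated integral over the cube [-1, 1]^n *)

Section Int1.
Variable R : realType.
Implicit Types (f g : R -> R).

(* The integral of a continuous function is defined through an antiderivative, so
   that linearity and the fundamental theorem need no integrability side
   conditions. *)
Definition anti f : R -> R :=
  get [set F : R -> R | forall t, -2 < t < 2 -> der F t (f t)].

Definition int1 f : R := anti f 1 - anti f (-1).

Lemma antiP f t : (forall t, cts f t) -> -2 < t < 2 -> der (anti f) t (f t).
Proof.
move=> cf; have [|F hF] := @antiderivative R f (-2) 2 _ cf; first by lra.
by move: t; apply: (@getPex _ [set F : R -> R | forall t, -2 < t < 2 -> der F t (f t)]); exists F.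
Qed.

(** The margin of (-2, 2) around [-1, 1] gives [anti f] a two-sided derivative at the end points as
    well. *)
Lemma antiP1 f t : (forall t, cts f t) -> -1 <= t <= 1 -> der (anti f) t (f t).
Proof. by move=> cf t1; apply: antiP => //; lra. Qed.

Lemma int1_FTC f F : (forall t, cts f t) ->
  (forall t, -1 <= t <= 1 -> der F t (f t)) -> int1 f = F 1 - F (-1).
Proof.
move=> cf dF; rewrite /int1.
have : anti f (-1) - F (-1) = anti f 1 - F 1.
  apply: (@der0_cst _ (fun t => anti f t - F t)); first by lra.
  move=> t t1; apply: (der_eq (derB (antiP1 cf t1) (dF t t1))).
  by rewrite subrr.
lra.
Qed.

Lemma int1_lin a f g : (forall t, cts f t) -> (forall t, cts g t) ->
  int1 (fun t => a * f t + g t) = a * int1 f + int1 g.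
Proof.
move=> cf cg; rewrite (@int1_FTC _ (fun t => a * anti f t + anti g t)).
- by rewrite /int1; ring.
- by move=> t; apply: ctsD => //; apply: ctsM => //; exact: cts_cst.
move=> t t1; apply: derD; last exact: antiP1.
by apply: (der_eq (derM (der_cst a t) (antiP1 cf t1))); ring.
Qed.

Lemma int1_cst c : int1 (fun=> c) = c * 2.
Proof.
rewrite (@int1_FTC _ (fun t => c * t)); first by ring.
- by move=> t; exact: cts_cst.
- by move=> t _; apply: (der_eq (derM (der_cst c t) (der_id t))); ring.
Qed.

Lemma anti_homo f s t : (forall t, cts f t) -> (forall t, -1 <= t <= 1 -> 0 <= f t) ->
  -1 <= s -> s <= t -> t <= 1 -> anti f s <= anti f t.
Proof.
move=> cf f0 s1; rewrite le_eqVlt => /orP[/eqP->//|st] t1.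
have [||c /andP[c1 c2] E] := @der_MVT _ (anti f) f s t st.
- by move=> r r1; apply: der_cts; apply: antiP1 => //; lra.
- by move=> r r1; apply: antiP1 => //; lra.
by rewrite -subr_ge0 E mulr_ge0 ?f0//; lra.
Qed.

Lemma int1_ge0 f : (forall t, cts f t) -> (forall t, -1 <= t <= 1 -> 0 <= f t) ->
  0 <= int1 f.
Proof. by move=> cf f0; rewrite subr_ge0; apply: anti_homo => //; lra. Qed.

(** If the integral were 0, the monotone primitive would be constant on [-1, 1], and its derivative
    [f s] at the interior point [s] would be 0. *)
Lemma int1_gt0 f s : (forall t, cts f t) -> (forall t, -1 <= t <= 1 -> 0 <= f t) ->
  -1 < s < 1 -> 0 < f s -> 0 < int1 f.
Proof.
move=> cf f0 s1 fs; rewrite lt_neqAle int1_ge0// andbT; apply/eqP => E.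
have cst t : -1 <= t <= 1 -> anti f t = anti f 1.
  move=> t1; apply/eqP; rewrite eq_le anti_homo//=; try lra.
  suff : anti f (-1) <= anti f t by move: E; rewrite /int1; lra.
  by apply: anti_homo => //; lra.
have d0 : der (anti f) s 0.
  apply: (@der_near _ (fun=> anti f 1)); last exact: der_cst.
  have h1 : \forall t \near s, -1 < t by apply: lt_nbhsr; lra.
  have h2 : \forall t \near s, t < 1 by apply: lt_nbhsl; lra.
  by apply: filterS2 h1 h2 => t t1 t2; rewrite cst//; lra.
have s11 : -1 <= s <= 1 by lra.
have := der_uniq d0 (antiP1 cf s11); lra.
Qed.

End Int1.

Section Box.
Variable R : realType.

Definition vcons n (t : R) (z : 'rV[R]_n) : 'rV[R]_n.+1 :=
  \row_k (if unlift ord0 k is Some j then z 0 j else t).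

Fixpoint box n : ('rV[R]_n -> R) -> R :=
  if n is m.+1 then fun f => int1 (fun t => box (fun z : 'rV_m => f (vcons t z)))
  else fun f => f 0.

Definition inbox n (z : 'rV[R]_n) := forall k, -1 <= z 0 k <= 1.

Lemma vcons0 n t (z : 'rV[R]_n) : vcons t z 0 ord0 = t.
Proof. by rewrite mxE unlift_none. Qed.

Lemma vconsS n t (z : 'rV[R]_n) k : vcons t z 0 (lift ord0 k) = z 0 k.
Proof. by rewrite mxE liftK. Qed.

Lemma vconsP n (p : 'rV[R]_n.+1) : exists t z, p = vcons t z.
Proof.
exists (p 0 ord0), (\row_k p 0 (lift ord0 k)); apply/rowP => k.
by case: (unliftP ord0 k) => [j|] ->; rewrite ?vconsS ?vcons0 ?mxE.
Qed.

Lemma inbox_vcons n t (z : 'rV[R]_n) : inbox (vcons t z) <-> (-1 <= t <= 1) /\ inbox z.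
Proof.
split=> [h|[ht hz] k].
  by split=> [|k]; [have := h ord0; rewrite vcons0|have := h (lift ord0 k); rewrite vconsS].
by case: (unliftP ord0 k) => [j|] ->; rewrite ?vconsS ?vcons0.
Qed.

Lemma inbox_compact n : compact [set z : 'rV[R]_n | inbox z].
Proof.
have := @rV_compact R n (fun=> `[-1, 1]%classic) (fun=> @segment_compact _ _ _).
by congr (compact _); apply/seteqP; split=> z /= h k; have := h k; rewrite /= in_itv.
Qed.

Lemma vcons_cts (T : topologicalType) n (s : T -> R) (h : T -> 'rV[R]_n) a :
  cts s a -> h b @[b --> a] --> h a -> vcons (s b) (h b) @[b --> a] --> vcons (s a) (h a).
Proof.
move=> cs ch; apply: cts_row => k; case: (unliftP ord0 k) => [j|] ->.
  under [X in cts X]eq_fun do rewrite vconsS.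
  exact: (cts_comp (@cts_coord _ _ j (h a)) ch).
by under [X in cts X]eq_fun do rewrite vcons0.
Qed.

(** Compactness of the cube makes continuity in the parameter uniform in [z]. Both F (b, z') and F
    (a, z') are compared with the value at the centre of a covering neighbourhood, hence the two
    halves of [e]. *)
Lemma tube (T : topologicalType) n (F : T * 'rV[R]_n -> R) a e : 0 < e ->
  (forall z, cts F (a, z)) ->
  \forall b \near a, forall z, inbox z -> `|F (b, z) - F (a, z)| < e.
Proof.
move=> e0 cF.
have /compact_near_coveringP/(_ _ (nbhs a) (fun b z => `|F (b, z) - F (a, z)| < e)) := @inbox_compact n.
apply => z _; have e20 : 0 < e / 2 by rewrite divr_gt0.
have /cvgrPdist_lt/(_ _ e20) [[A B] /= [nA nB] AB] := cF z.
exists (B, A) => //= -[z' b] /= [Bz' Ab].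
have /= h1 := AB (b, z') (conj Ab Bz').
have /= h2 := AB (a, z') (conj (nbhs_singleton nA) Bz').
rewrite (_ : F (b, z') - F (a, z') = (F (a, z) - F (a, z')) - (F (a, z) - F (b, z'))); last by ring.
by rewrite (le_lt_trans (ler_normB _ _))// [e]splitr ltrD.
Qed.

(** These properties are bundled for one induction on [n]: in dimension n + 1 they require the inner
    integral to be continuous in the outer variable, and that continuity is deduced from the same
    three properties in dimension [n]. *)
Definition box_ok n :=
  [/\ (forall a f g, (forall z, cts f z) -> (forall z, cts g z) ->
        box (fun z : 'rV[R]_n => a * f z + g z) = a * box f + box g),
      (forall f, (forall z, cts f z) -> (forall z, inbox z -> 0 <= f z) ->
        0 <= box (f : 'rV[R]_n -> R)) &
      (forall c, box (fun _ : 'rV[R]_n => c) = c * 2 ^+ n)].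

Lemma box_ok_cts n (T : topologicalType) (F : T * 'rV[R]_n -> R) a : box_ok n ->
  (forall b z, cts (fun z => F (b, z)) z) -> (forall z, cts F (a, z)) ->
  cts (fun b => box (fun z => F (b, z))) a.
Proof.
move=> [lin ge0 bcst] cF cFa; apply/cvgrPdist_le => e e0.
(* 2^n is the volume of the cube, so a pointwise error [d] integrates to [e]. *)
pose d := e / 2 ^+ n; have d0 : 0 < d by rewrite divr_gt0// exprn_gt0.
have ed : e = d * 2 ^+ n by rewrite /d mulfVK// expf_neq0.
have := tube d0 cFa; apply: filterS => b hb.
have key (b1 b2 : T) : (forall z, inbox z -> F (b1, z) <= F (b2, z) + d) ->
    box (fun z => F (b1, z)) <= box (fun z => F (b2, z)) + e.
  move=> h; have cd : forall z : 'rV[R]_n, cts (fun z => F (b2, z) + d) z.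
    by move=> z; apply: ctsD => //; exact: cts_cst.
  have := @ge0 (fun z => -1 * F (b1, z) + (1 * F (b2, z) + d)).
  rewrite lin//; last first.
    by move=> z; under [X in cts X]eq_fun do rewrite mul1r; exact: cd.
  rewrite lin// ?bcst -?ed; last by move=> z; exact: cts_cst.
  have H z : cts (fun z => -1 * F (b1, z) + (1 * F (b2, z) + d)) z.
    apply: ctsD; first by apply: ctsM => //; exact: cts_cst.
    by under [X in cts X]eq_fun do rewrite mul1r; exact: cd.
  move=> /(_ H) H2; rewrite -subr_ge0.
  rewrite (_ : _ - _ = -1 * box (fun z => F (b1, z)) + (1 * box (fun z => F (b2, z)) + e)); last by ring.
  by apply: H2 => z /h; lra.
have K1 : box (fun z => F (a, z)) <= box (fun z => F (b, z)) + e.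
  by apply: key => z /hb; rewrite ltr_norml; lra.
have K2 : box (fun z => F (b, z)) <= box (fun z => F (a, z)) + e.
  by apply: key => z /hb; rewrite ltr_norml; lra.
by rewrite ler_norml; lra.
Qed.

Lemma slice_cts n (f : 'rV[R]_n.+1 -> R) : (forall z, cts f z) ->
  forall tz, cts (fun tz : R * 'rV[R]_n => f (vcons tz.1 tz.2)) tz.
Proof.
move=> cf [t z]; apply: (cts_comp (cf _)).
by apply: vcons_cts; [exact: cvg_fst|exact: cvg_snd].
Qed.

Lemma slice_ctsr n (f : 'rV[R]_n.+1 -> R) : (forall z, cts f z) ->
  forall t z, cts (fun z : 'rV[R]_n => f (vcons t z)) z.
Proof.
move=> cf t z; apply: (cts_comp (cf _)).
by apply: vcons_cts; [exact: cts_cst|exact: cvg_id].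
Qed.

Lemma box_ok_slice n (f : 'rV[R]_n.+1 -> R) : box_ok n -> (forall z, cts f z) ->
  forall t, cts (fun t => box (fun z : 'rV[R]_n => f (vcons t z))) t.
Proof.
move=> ok cf t; apply: (@box_ok_cts _ _ (fun tz => f (vcons tz.1 tz.2))) => //.
  by move=> b z; exact: slice_ctsr.
by move=> z; exact: slice_cts.
Qed.

Lemma boxP n : box_ok n.
Proof.
elim: n => [|n ok]; first split=> //=.
- by move=> f _; apply => -[].
- by move=> c; rewrite expr0 mulr1.
have sl f := @box_ok_slice n f ok.
case: (ok) => lin ge0 bcst; split => /=.
- move=> a f g cf cg; rewrite -int1_lin; [|exact: sl|exact: sl].
  by congr int1; apply/funext => t; apply: lin => z; exact: slice_ctsr.
- move=> f cf f0; apply: int1_ge0; first exact: sl.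
  move=> t t1; apply: ge0 => [z|z z1]; first exact: slice_ctsr.
  by apply: f0; exact/inbox_vcons.
- move=> c; under [X in int1 X]eq_fun do rewrite bcst.
  by rewrite int1_cst exprS; ring.
Qed.

Lemma box_lin n a (f g : 'rV[R]_n -> R) : (forall z, cts f z) -> (forall z, cts g z) ->
  box (fun z => a * f z + g z) = a * box f + box g.
Proof. by case: (boxP n) => + _ _; apply. Qed.

Lemma box_ge0 n (f : 'rV[R]_n -> R) : (forall z, cts f z) ->
  (forall z, inbox z -> 0 <= f z) -> 0 <= box f.
Proof. by case: (boxP n) => _ + _; apply. Qed.

Lemma box_cst n c : box (fun _ : 'rV[R]_n => c) = c * 2 ^+ n.
Proof. by case: (boxP n). Qed.

Lemma box0 n : box (fun _ : 'rV[R]_n => 0) = 0.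
Proof. by rewrite box_cst mul0r. Qed.

Lemma boxD n (f g : 'rV[R]_n -> R) : (forall z, cts f z) -> (forall z, cts g z) ->
  box (fun z => f z + g z) = box f + box g.
Proof.
move=> cf cg; rewrite -[box f]mul1r -box_lin//.
by congr box; apply/funext => z; rewrite mul1r.
Qed.

Lemma boxZ n a (f : 'rV[R]_n -> R) : (forall z, cts f z) ->
  box (fun z => a * f z) = a * box f.
Proof.
move=> cf; rewrite -[RHS]addr0 -(box0 n) -box_lin//; last by move=> z; exact: cts_cst.
by congr box; apply/funext => z; rewrite addr0.
Qed.

Lemma boxB n (f g : 'rV[R]_n -> R) : (forall z, cts f z) -> (forall z, cts g z) ->
  box (fun z => f z - g z) = box f - box g.
Proof.
move=> cf cg; rewrite addrC -mulN1r -box_lin//.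
by congr box; apply/funext => z; rewrite mulN1r addrC.
Qed.

Lemma box_sum n (I : Type) (r : seq I) (P : pred I) (F : I -> 'rV[R]_n -> R) :
  (forall i z, cts (F i) z) ->
  box (fun z => \sum_(i <- r | P i) F i z) = \sum_(i <- r | P i) box (F i).
Proof.
move=> cF; elim: r => [|i r ih].
  by under [X in box X]eq_fun do rewrite big_nil; rewrite big_nil box0.
under [X in box X]eq_fun do rewrite big_cons; rewrite big_cons -ih.
case: (P i) => //; rewrite boxD// => z; exact: cts_sum.
Qed.

Lemma box_le n (f g : 'rV[R]_n -> R) : (forall z, cts f z) -> (forall z, cts g z) ->
  (forall z, inbox z -> f z <= g z) -> box f <= box g.
Proof.
move=> cf cg fg; rewrite -subr_ge0 -boxB//; apply: box_ge0.
  by move=> z; exact: ctsB.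
by move=> z /fg; rewrite subr_ge0.
Qed.

Lemma box_eq n (f g : 'rV[R]_n -> R) : (forall z, cts f z) -> (forall z, cts g z) ->
  (forall z, inbox z -> f z = g z) -> box f = box g.
Proof.
by move=> cf cg fg; apply/eqP; rewrite eq_le !box_le// => z /fg->.
Qed.

Lemma box_gt0 n (f : 'rV[R]_n -> R) (p : 'rV[R]_n) : (forall z, cts f z) ->
  (forall z, inbox z -> 0 <= f z) -> (forall k, -1 < p 0 k < 1) -> 0 < f p -> 0 < box f.
Proof.
elim: n f p => [|n ih] f p cf f0 hp fp /=.
  by rewrite (_ : 0 = p)//; apply/rowP => -[].
have [t [z pE]] := vconsP p; rewrite pE in fp hp.
apply: (@int1_gt0 _ _ t).
- exact: box_ok_slice (boxP n) cf.
- move=> s s1; apply: box_ge0 => [y|y y1]; first exact: slice_ctsr.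
  by apply: f0; apply/inbox_vcons.
- by have := hp ord0; rewrite vcons0.
apply: (ih _ z) => //.
- exact: slice_ctsr.
- move=> y y1; apply: f0; apply/inbox_vcons; split=> //.
  by have := hp ord0; rewrite vcons0; lra.
- by move=> k; have := hp (lift ord0 k); rewrite vconsS.
Qed.

Lemma box_cts n (T : topologicalType) (F : T * 'rV[R]_n -> R) a :
  (forall b z, cts (fun z => F (b, z)) z) -> (forall z, cts F (a, z)) ->
  cts (fun b => box (fun z => F (b, z))) a.
Proof. exact: box_ok_cts (boxP n). Qed.

End Box.

(** * Directional derivatives *)

Section DirDer.
Variable R : realType.

Lemma der_MVT0 (f df : R -> R) h : (forall t, `|t| <= `|h| -> der f t (df t)) ->
  exists2 c, `|c| <= `|h| & f h - f 0 = df c * h.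
Proof.
move=> hf; have [h0|h0|->] := ltgtP h 0; last first.
- by exists 0; rewrite ?normr0// subrr mulr0.
- have [||c /andP[c1 c2] E] := @der_MVT _ f df 0 h h0.
  + by move=> t t1; apply: (der_cts (hf _ _)); rewrite !ger0_norm; lra.
  + by move=> t t1; apply: hf; rewrite !ger0_norm; lra.
  by exists c; [rewrite !ger0_norm; lra|lra].
- have [||c /andP[c1 c2] E] := @der_MVT _ f df h 0 h0.
  + by move=> t t1; apply: (der_cts (hf _ _)); rewrite !ler0_norm; lra.
  + by move=> t t1; apply: hf; rewrite !ler0_norm; lra.
  by exists c; [rewrite !ler0_norm; lra|lra].
Qed.

(** A relation on one real variable, so that all the rules for [der] apply to directional
    derivatives verbatim. *)
Definition dder n (f : 'rV[R]_n -> R) (v p : 'rV[R]_n) (l : R) :=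
  der (fun t => f (p + t *: v)) 0 l.

Lemma derivable_dder n (f : 'rV[R]_n -> R) (v p : 'rV[R]_n) :
  derivable f p v -> dder f v p ('D_v f p).
Proof.
move=> df; have [d1 d2] := derivable1P f p v; have := d1 df.
rewrite /dder /der (_ : (fun t => f (p + t *: v)) = (fun t => f (t *: v + p))); last first.
  by apply/funext => t; rewrite addrC.
move=> df'; split => //; rewrite /derive.
set g1 := fun h => h^-1 *: _; set g2 := fun h => h^-1 *: _.
suff -> : g1 = g2 by [].
by apply/funext => h; rewrite /g1 /g2 /=; rewrite addr0 scale0r add0r [_%:A]mulr1.
Qed.

Lemma der_shift (f : R -> R) t l : der (fun s => f (t + s)) 0 l -> der f t l.
Proof.
move=> df; rewrite (_ : f = fun s => (fun r => f (t + r)) (s - t)); last first.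
  by apply/funext => s; rewrite addrC subrK.
rewrite -[l]mulr1; apply: (@der_comp _ (fun r => f (t + r)) (fun s => s - t) t l 1).
  by apply: (der_eq (derB (der_id t) (der_cst t t))); rewrite subr0.
by rewrite subrr.
Qed.

Lemma dder_line n (f l : 'rV[R]_n -> R) (v p : 'rV[R]_n) t :
  (forall q, dder f v q (l q)) -> der (fun t => f (p + t *: v)) t (l (p + t *: v)).
Proof.
move=> df; apply: der_shift; have := df (p + t *: v); rewrite /dder.
by congr der; apply/funext => s; rewrite scalerDl addrA.
Qed.

Lemma dderZ n (f : 'rV[R]_n -> R) (v p : 'rV[R]_n) a l : dder f v p l -> dder f (a *: v) p (a * l).
Proof.
move=> df; rewrite mulrC /dder.
under [X in der X]eq_fun do rewrite scalerA.
apply: (@der_comp _ (fun t => f (p + t *: v)) (fun t => t * a)); last by rewrite mul0r.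
by apply: (der_eq (derM (der_id 0) (der_cst a 0))); rewrite mulr0 addr0 mul1r.
Qed.

Lemma cts2_ball (g : R * R -> R) e : 0 < e -> cts g (0, 0) ->
  exists2 d, 0 < d & forall a b, `|a| < d -> `|b| < d -> `|g (a, b) - g (0, 0)| < e.
Proof.
move=> e0 /cvgrPdist_lt /(_ _ e0) /nbhs_ballP [d /= d0 hd]; exists d => // a b ad bd.
rewrite distrC; apply: (hd (a, b)).
by split; rewrite /= /ball /= sub0r normrN.
Qed.

Lemma cts_plane n (g : 'rV[R]_n -> R) (p v w : 'rV[R]_n) : cts g p ->
  cts (fun ab : R * R => g (p + ab.1 *: v + ab.2 *: w)) (0, 0).
Proof.
move=> cg; apply: (@cts_comp _ _ _ g (fun ab : R * R => p + ab.1 *: v + ab.2 *: w)).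
  by rewrite /= !scale0r !addr0.
apply: cvgD; first apply: cvgD; first exact: cvg_cst.
  by apply: cvgZr_tmp; exact: cvg_fst.
by apply: cvgZr_tmp; exact: cvg_snd.
Qed.

(** The increment along v + w is split into a step along [v] and then one along [w] from the shifted
    point. The mean value theorem rewrites the second step, and continuity of [dw] brings the
    intermediate point back to [p]. *)
Lemma dderD n (f dv dw : 'rV[R]_n -> R) (v w p : 'rV[R]_n) :
  dder f v p (dv p) -> (forall q, dder f w q (dw q)) -> cts dw p ->
  dder f (v + w) p (dv p + dw p).
Proof.
move=> hv hw cw; apply/derP => e e0.
have e20 : 0 < e / 2 by rewrite divr_gt0.
have /derP /(_ _ e20) [d1 d10 hd1] := hv.
have [d2 d20 hd2] := cts2_ball e20 (cts_plane (v := v) (w := w) cw).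
exists (Num.min d1 d2); first by rewrite lt_min d10.
move=> h h0; rewrite lt_min => /andP[h1 h2].
have [c cle E] := @der_MVT0 (fun t => f (p + h *: v + t *: w))
  (fun t => dw (p + h *: v + t *: w)) h (fun t _ => dder_line _ _ hw).
have := hd1 h h0 h1; have := hd2 h c h2 (le_lt_trans cle h2).
move: E; rewrite /= !scale0r !addr0 !add0r scalerDr addrA => E.
rewrite (_ : f (p + h *: v + h *: w) - f p = dw (p + h *: v + c *: w) * h +
  (f (p + h *: v) - f p)); last by rewrite -E; ring.
move=> A B; rewrite (_ : _ - _ = (dw (p + h *: v + c *: w) - dw p) +
  (h^-1 * (f (p + h *: v) - f p) - dv p)); last by field.
by rewrite (le_lt_trans (ler_normD _ _))// [e]splitr ltrD.
Qed.

Definition C1 n (f : 'rV[R]_n -> R) := (forall p, cts f p) /\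
  forall i, (forall p, dder f (basisv R i) p (pderiv i f p)) /\ forall p, cts (pderiv i f) p.

Lemma C1_dder n (f : 'rV[R]_n -> R) (v p : 'rV[R]_n) : C1 f ->
  dder f v p (\sum_i v 0 i * pderiv i f p).
Proof.
move=> [cf hf]; rewrite {1}(row_sum_delta v).
elim: (index_enum _) p => [|i r ih] p.
  by rewrite !big_nil /dder; under [X in der X]eq_fun do rewrite scaler0 addr0; exact: der_cst.
rewrite !big_cons addrC [X in dder _ _ _ X]addrC.
apply: (dderD (dv := fun p => \sum_(j <- r) v 0 j * pderiv j f p)
  (dw := fun p => v 0 i * pderiv i f p)) => //.
  by move=> q; apply: dderZ; case: (hf i).
by apply: ctsM; [exact: cts_cst|case: (hf i)].
Qed.

End DirDer.

(** * Symmetry of second derivatives, differentiation under the integral, integration by parts on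
    the cube *)

Section SchwarzBox.
Variable R : realType.

(* Schwarz's theorem, through the second difference of f. *)
Lemma dder_sym n (f fv fw fvw fwv : 'rV[R]_n -> R) (v w p : 'rV[R]_n) :
  (forall q, dder f v q (fv q)) -> (forall q, dder f w q (fw q)) ->
  (forall q, dder fv w q (fvw q)) -> (forall q, dder fw v q (fwv q)) ->
  cts fvw p -> cts fwv p -> fvw p = fwv p.
Proof.
move=> hv hw hvw hwv cvw cwv.
apply/eqP; rewrite -subr_eq0 -normr_eq0 eq_le normr_ge0 andbT.
apply/ler_addgt0Pl => e e0; rewrite addr0.
have e20 : 0 < e / 2 by rewrite divr_gt0.
have [d1 d10 hd1] := cts2_ball e20 (cts_plane (v := v) (w := w) cvw).
have [d2 d20 hd2] := cts2_ball e20 (cts_plane (v := w) (w := v) cwv).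
pose h := Num.min d1 d2 / 2.
have m0 : 0 < Num.min d1 d2 by rewrite lt_min d10.
have h0 : 0 < h by rewrite divr_gt0.
have /andP[h1 h2] : (`|h| < d1) && (`|h| < d2).
  by rewrite -lt_min gtr0_norm// /h ltr_pdivrMr// mulr_natr mulr2n ltrDl.
have sq (g gv gvw : 'rV[R]_n -> R) (a b : 'rV[R]_n) :
    (forall q, dder g a q (gv q)) -> (forall q, dder gv b q (gvw q)) ->
    exists c c', [/\ `|c| <= `|h|, `|c'| <= `|h| &
    g (p + h *: b + h *: a) - g (p + h *: a) - (g (p + h *: b) - g p) =
      gvw (p + c *: a + c' *: b) * h * h].
  move=> ha hb.
  have [t _|c cle E] := @der_MVT0 R (fun t => g (p + h *: b + t *: a) - g (p + t *: a))
    (fun t => gv (p + h *: b + t *: a) - gv (p + t *: a)) h.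
    by apply: derB; exact: dder_line.
  have [t _|c' c'le E'] := @der_MVT0 R (fun t => gv (p + c *: a + t *: b))
    (fun t => gvw (p + c *: a + t *: b)) h.
    exact: dder_line.
  exists c, c'; split => //; move: E E'; rewrite /= !scale0r !addr0 => E E'.
  by rewrite E -E' [p + c *: a + _]addrAC.
have [c1 [c2 [c1h c2h E1]]] := sq _ _ _ _ _ hv hvw.
have [c3 [c4 [c3h c4h E2]]] := sq _ _ _ _ _ hw hwv.
have := hd1 c1 c2 (le_lt_trans c1h h1) (le_lt_trans c2h h1).
have := hd2 c3 c4 (le_lt_trans c3h h2) (le_lt_trans c4h h2).
rewrite /= !scale0r !addr0.
have -> : fwv (p + c3 *: w + c4 *: v) = fvw (p + c1 *: v + c2 *: w).
  apply: (mulIf (lt0r_neq0 h0)); apply: (mulIf (lt0r_neq0 h0)).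
  by rewrite -E1 -E2 [p + h *: v + _]addrAC; ring.
set k := fvw (_ + _ + _) => A B.
rewrite (_ : fvw p - fwv p = (k - fwv p) - (k - fvw p)); last by ring.
by rewrite (le_trans (ler_normB _ _))// [e]splitr lerD// ltW.
Qed.

(** The mean value theorem replaces the difference quotient by [F'] at an intermediate time, and
    [tube] makes its distance to [F' t0] uniformly small on the cube. *)
Lemma box_der n (F F' : R -> 'rV[R]_n -> R) t0 r : 0 < r ->
  (forall t z, cts (F t) z) ->
  (forall t z, `|t - t0| < r -> der (F^~ z) t (F' t z)) ->
  (forall z, cts (fun tz : R * 'rV[R]_n => F' tz.1 tz.2) (t0, z)) ->
  der (fun t => box (F t)) t0 (box (F' t0)).
Proof.
move=> r0 cF dF cF'; apply/derP => e e0.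
have cF'0 z : cts (F' t0) z.
  apply: (@cts_comp _ _ _ (fun tz : R * 'rV[R]_n => F' tz.1 tz.2) (fun z => (t0, z))) => //.
  by apply: (@cvg_pairT _ _ _ (fun=> t0) id z); [exact: cts_cst|exact: cvg_id].
(* Half of [e] is kept in reserve: integration preserves only weak inequalities, while a strict
   bound by [e] is required. *)
pose d := e / 2 / 2 ^+ n; have d0 : 0 < d by rewrite !divr_gt0// exprn_gt0.
have ed : d * 2 ^+ n = e / 2 by rewrite /d mulfVK// expf_neq0.
have := tube d0 cF' => /nbhs_ballP[d' /= d'0 hd'].
exists (Num.min d' r); first by rewrite lt_min d'0.
move=> h h0; rewrite lt_min => /andP[hd hr].
have key z : inbox z -> `|h^-1 * (F (t0 + h) z - F t0 z) - F' t0 z| < d.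
  move=> z1; have [t tle|c cle] := @der_MVT0 R (fun t => F (t0 + t) z) (fun t => F' (t0 + t) z) h.
    apply: der_shift; under [X in der X]eq_fun do rewrite addrA.
    rewrite -[F' _ _]mulr1; apply: (@der_comp R (F^~ z) (fun s => t0 + t + s)).
      by apply: (der_eq (derD (der_cst (t0 + t) 0) (der_id 0))); rewrite add0r.
    by rewrite addr0; apply: dF; rewrite addrAC subrr add0r (le_lt_trans tle).
  rewrite addr0 => ->; rewrite mulrC mulfK//; apply: hd' => //.
  by rewrite /ball /= opprD addrA subrr add0r normrN (le_lt_trans cle).
have cq z : cts (fun z => h^-1 * (F (t0 + h) z - F t0 z) - F' t0 z) z.
  by apply: ctsB => //; apply: ctsM; [exact: cts_cst|exact: ctsB].
have cc c (z : 'rV[R]_n) : cts (fun=> c) z by exact: cts_cst.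
have E : box (fun z => h^-1 * (F (t0 + h) z - F t0 z) - F' t0 z) =
    h^-1 * (box (F (t0 + h)) - box (F t0)) - box (F' t0).
  have cq' z : cts (fun z => F (t0 + h) z - F t0 z) z by exact: ctsB.
  rewrite boxB//; last by move=> z; apply: ctsM.
  by rewrite boxZ// boxB.
rewrite -E.
have B1 : box (fun z => h^-1 * (F (t0 + h) z - F t0 z) - F' t0 z) <= e / 2.
  rewrite -ed -box_cst; apply: box_le => // z /key; rewrite ltr_norml; lra.
have B2 : - (e / 2) <= box (fun z => h^-1 * (F (t0 + h) z - F t0 z) - F' t0 z).
  rewrite -ed -mulNr -box_cst; apply: box_le => // z /key; rewrite ltr_norml; lra.
by rewrite ltr_norml; lra.
Qed.

Lemma vcons_addS n t (z : 'rV[R]_n) s j :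
  vcons t z + s *: basisv R (lift ord0 j) = vcons t (z + s *: basisv R j).
Proof.
apply/rowP => i; rewrite mxE; case: (unliftP ord0 i) => [l|] ->.
  by rewrite !vconsS /basisv !mxE eqxx.
by rewrite !vcons0 /basisv !mxE eqxx mulr0 addr0.
Qed.

Lemma vcons_add0 n t (z : 'rV[R]_n) s :
  vcons t z + s *: basisv R ord0 = vcons (t + s) z.
Proof.
apply/rowP => i; rewrite mxE; case: (unliftP ord0 i) => [l|] ->.
  by rewrite !vconsS /basisv !mxE eqxx mulr0 addr0.
by rewrite !vcons0 /basisv !mxE eqxx mulr1.
Qed.

(** By induction on the dimension: a derivative in the outermost variable is moved outside the inner
    integral and handled by the fundamental theorem; any other one already vanishes in the inner
    integral. *)
Lemma box_div n (k : 'I_n) (F F' : 'rV[R]_n -> R) :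
  (forall z, cts F z) -> (forall z, cts F' z) ->
  (forall z, dder F (basisv R k) z (F' z)) ->
  (forall z, inbox z -> `|z 0 k| = 1 -> F z = 0) -> box F' = 0.
Proof.
elim: n k F F' => [[]//|n ih] k F F' cF cF' dF F0 /=.
have cc c (z : 'rV[R]_n) : cts (fun=> c) z by exact: cts_cst.
case: (unliftP ord0 k) => [j kE|kE]; rewrite kE in dF F0.
  (* The inner integral is 0 for every t in [-1, 1], so the zero function is a primitive of it
     there. *)
  rewrite (@int1_FTC _ _ (fun=> 0)) ?subrr// => [t|t t1].
    by apply: box_ok_slice => //; exact: boxP.
  rewrite (ih j (fun z => F (vcons t z)) (fun z => F' (vcons t z))); first exact: der_cst.
  - exact: slice_ctsr.
  - exact: slice_ctsr.
  - move=> z; have := dF (vcons t z); rewrite /dder; congr der; apply/funext => s.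
    by rewrite vcons_addS.
  - move=> z z1 zj; apply: F0; rewrite ?vconsS//.
    by apply/inbox_vcons.
rewrite (@int1_FTC _ _ (fun t => box (fun z => F (vcons t z)))).
- rewrite (@box_eq _ _ _ (fun=> 0)) ?box0//; last 2 first.
  + exact: slice_ctsr.
  + by move=> z z1; apply: F0; rewrite ?vcons0 ?normr1//; apply/inbox_vcons; split => //; lra.
  rewrite (@box_eq _ _ _ (fun=> 0)) ?box0 ?subrr//.
  + exact: slice_ctsr.
  + by move=> z z1; apply: F0; rewrite ?vcons0 ?normrN1//; apply/inbox_vcons; split => //; lra.
- by move=> t; apply: box_ok_slice => //; exact: boxP.
move=> t t1; apply: (@box_der _ _ (fun t z => F' (vcons t z)) t 1) => //.
- by move=> s z; exact: slice_ctsr.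
- move=> s z _; apply: der_shift; have := dF (vcons s z); rewrite /dder.
  by congr der; apply/funext => r; rewrite vcons_add0.
- by move=> z; exact: slice_cts.
Qed.

End SchwarzBox.

(** * Weighted means in y *)

Section PosPow.
Variable R : realType.
Implicit Types a t : R.

(** The truncated power a_+^m. At exponent 0 it is the constant 1 and not an indicator, so vanishing
    for a <= 0 starts at exponent 1 and differentiability at exponent 2. *)
Definition pospow m a := Num.max 0 a ^+ m.

Lemma pospow_ge0 m a : 0 <= pospow m a.
Proof. by rewrite exprn_ge0// le_max lexx. Qed.

Lemma pospow_gt0 m a : 0 < a -> 0 < pospow m a.
Proof. by move=> a0; rewrite exprn_gt0// lt_max a0 orbT. Qed.

Lemma pospow_npos m a : a <= 0 -> pospow m.+1 a = 0.
Proof. by move=> a0; rewrite /pospow max_l// expr0n. Qed.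

Lemma pospowS m a : pospow m.+2 a = a * pospow m.+1 a.
Proof.
have [a0|a0] := leP a 0; first by rewrite !pospow_npos// mulr0.
by rewrite /pospow max_r ?ltW// exprS.
Qed.

Lemma pospow_cts m a : cts (pospow m) a.
Proof. by apply: ctsX; apply: cts_max; [exact: cts_cst|exact: cvg_id]. Qed.

Lemma pospow_der m a : der (pospow m.+2) a (m.+2%:R * pospow m.+1 a).
Proof.
have [a0|a0|->] := ltgtP a 0.
- rewrite pospow_npos ?ltW// mulr0; apply: (@der_near _ (fun=> 0)); last exact: der_cst.
  have := lt_nbhsl a0; apply: filterS => t t0; by rewrite pospow_npos// ltW.
- apply: (@der_near _ (fun t => t ^+ m.+2)).
    have := lt_nbhsr a0; apply: filterS => t t0; by rewrite /pospow max_r// ltW.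
  apply: (der_eq (derXn m.+1 (der_id a))).
  by rewrite mulr1 /pospow max_r// ltW.
(* At 0 the difference quotient is 0 for negative [h] and h^(m+1) <= h for 0 < h < 1. *)
rewrite pospow_npos// mulr0; apply/derP => e e0.
exists (Num.min e 1); first by rewrite lt_min e0 ltr01.
move=> h h0; rewrite lt_min => /andP[he h1].
rewrite add0r [pospow _ 0]pospow_npos// !subr0.
have [hn|hp] := leP h 0; first by rewrite pospow_npos// mulr0 normr0.
rewrite /pospow max_r ?ltW// exprS mulKf// exprS normrM (le_lt_trans _ he)//.
by rewrite ler_piMr// normrX exprn_ile1// ltW.
Qed.

End PosPow.

Section Ker.
Variables (R : realType) (d : nat).
Implicit Types z : 'rV[R]_d.

Definition sqn z : R := \sum_k z 0 k ^+ 2.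

Definition ker m z : R := pospow m (1 - sqn z).

Lemma sqn_cts z : cts sqn z.
Proof. by apply: cts_sum => k; apply: ctsX; exact: cts_coord. Qed.

Lemma ker_cts m z : cts (ker m) z.
Proof.
apply: (@cts_comp _ _ _ (pospow m) (fun z => 1 - sqn z)); first exact: pospow_cts.
by apply: (@ctsB _ _ (fun=> 1) sqn); [exact: cts_cst|exact: sqn_cts].
Qed.

Lemma coord_dder k j z : dder (fun z => z 0 k) (basisv R j) z ((k == j)%:R).
Proof.
rewrite /dder (_ : (fun t : R => _) = fun t => z 0 k + t * (k == j)%:R); last first.
  by apply/funext => t; rewrite /basisv !mxE eqxx.
by apply: (der_eq (derD (der_cst _ _) (derM (der_id _) (der_cst _ _)))); ring.
Qed.

Lemma sqn_dder j z : dder sqn (basisv R j) z (2 * z 0 j).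
Proof.
rewrite /dder /sqn.
apply: (@der_eq _ _ _ (\sum_k 2 * z 0 k * (k == j)%:R)).
  apply: der_sum => k; have := derXn 1 (coord_dder k j z).
  by rewrite scale0r addr0 expr1.
rewrite (bigD1 j)//= eqxx mulr1 big1 ?addr0// => k kj.
by rewrite (negbTE kj) mulr0.
Qed.

(** Read from right to left, this writes z_j times a kernel as a derivative of the next kernel;
    integration by parts then exchanges a derivative in y_j for a factor z_j. *)
Lemma ker_dder m j z :
  dder (ker m.+2) (basisv R j) z (- (2 * m.+2%:R) * z 0 j * ker m.+1 z).
Proof.
rewrite /dder /ker.
have := @der_comp _ (pospow m.+2) (fun t => 1 - sqn (z + t *: basisv R j)) 0 _ _
  (derB (der_cst 1 0) (sqn_dder j z)) (pospow_der m (1 - sqn (z + 0 *: basisv R j))).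
by move=> H; apply: (der_eq H); rewrite scale0r addr0; ring.
Qed.

(** The unit ball is inscribed in the cube, so kernels of positive exponent vanish on the faces. *)
Lemma ker_bd m k z : `|z 0 k| = 1 -> ker m.+1 z = 0.
Proof.
move=> zk; rewrite /ker pospow_npos// subr_le0 /sqn (bigD1 k)//=.
by rewrite -real_normK ?num_real// zk expr1n lerDl sumr_ge0// => i _; exact: sqr_ge0.
Qed.

Lemma kerS m z : ker m.+2 z = (1 - sqn z) * ker m.+1 z.
Proof. exact: pospowS. Qed.

End Ker.

(** Continuity by recursion on the syntax of the function. Subtraction is matched before addition
    because [f - g] is an addition of an opposite. *)
Ltac ctk := lazymatch goal with
  | |- cts (fun _ => ?c) _ => exact: cts_cst
  | |- cts (fun z => @GRing.add _ (@?f z) (@GRing.opp _ (@?g z))) ?a =>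
      apply: (@ctsB _ _ f g a); ctk
  | |- cts (fun z => @GRing.add _ (@?f z) (@?g z)) ?a => apply: (@ctsD _ _ f g a); ctk
  | |- cts (fun z => @GRing.mul _ (@?f z) (@?g z)) ?a => apply: (@ctsM _ _ f g a); ctk
  | |- cts (fun z => @GRing.opp _ (@?f z)) ?a => apply: (@ctsN _ _ f a); ctk
  | |- cts (fun z => @GRing.exp _ (@?f z) ?n) ?a => apply: (@ctsX _ _ f n a); ctk
  | |- cts (fun z => @bigop _ _ _ _ _) _ => apply: cts_sum => ?; ctk
  | |- cts (fun z => fun_of_matrix z _ _) _ => exact: cts_coord
  | |- cts (fun z => ker _ z) _ => exact: ker_cts
  | |- cts (ker _) _ => exact: ker_cts
  | _ => first [ match goal with
      | H : cts ?f ?a |- cts ?f ?a => exact: H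
      | H : forall _, cts _ _ |- _ => exact: H
      | H : forall _ _, cts _ _ |- _ => exact: H
      end | idtac ]
  end.

Section Mean.
Variables (R : realType) (d1 d2 : nat).
Implicit Types (f : 'rV[R]_(d1 + d2) -> R) (w : 'rV[R]_d2 -> R)
  (x : 'rV[R]_d1) (y z : 'rV[R]_d2) (s : R).

(** Unnormalised, and scaled to a domain independent of [s]: derivatives in [s] pass under the
    integral, and s = 0 gives a multiple of the value at the centre. *)
Definition mean f w x y s := box (fun z => f (row_mx x (y + s *: z)) * w z).

Definition dx (i : 'I_d1) := @pderiv R (d1 + d2) (lshift d2 i).
Definition dy (j : 'I_d2) := @pderiv R (d1 + d2) (rshift d1 j).

Lemma row_mx_cts (T : topologicalType) (X : T -> 'rV[R]_d1) (Y : T -> 'rV[R]_d2) a :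
  X b @[b --> a] --> X a -> Y b @[b --> a] --> Y a ->
  row_mx (X b) (Y b) @[b --> a] --> row_mx (X a) (Y a).
Proof.
move=> cX cY; apply: cts_row => k; case: (split_ordP k) => j ->.
  under [X in cts X]eq_fun do rewrite row_mxEl.
  exact: (cts_comp (@cts_coord _ _ j (X a)) cX).
under [X in cts X]eq_fun do rewrite row_mxEr.
exact: (cts_comp (@cts_coord _ _ j (Y a)) cY).
Qed.

Lemma integrand_cts (T : topologicalType) f w (X : T -> 'rV[R]_d1)
    (Y Z : T -> 'rV[R]_d2) (S : T -> R) a :
  (forall p, cts f p) -> (forall z, cts w z) ->
  X b @[b --> a] --> X a -> Y b @[b --> a] --> Y a -> Z b @[b --> a] --> Z a -> cts S a ->
  cts (fun b => f (row_mx (X b) (Y b + S b *: Z b)) * w (Z b)) a.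
Proof.
move=> cf cw cX cY cZ cS; apply: ctsM; last exact: cts_comp.
apply: (@cts_comp _ _ _ f (fun b => row_mx (X b) (Y b + S b *: Z b))) => //.
apply: (@row_mx_cts _ X (fun b => Y b + S b *: Z b)) => //.
by apply: cvgD => //; exact: cvgZ.
Qed.

Lemma mean_cts_z f w x y s : (forall p, cts f p) -> (forall z, cts w z) ->
  forall z, cts (fun z => f (row_mx x (y + s *: z)) * w z) z.
Proof.
move=> cf cw z.
apply: (@integrand_cts _ f w (fun=> x) (fun=> y) id (fun=> s)) => //;
  by [exact: cvgT_cst|exact: cvg_id|exact: cts_cst].
Qed.

Lemma mean_cts (T : topologicalType) f w (X : T -> 'rV[R]_d1) (Y : T -> 'rV[R]_d2) (S : T -> R) a :
  (forall p, cts f p) -> (forall z, cts w z) ->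
  X b @[b --> a] --> X a -> Y b @[b --> a] --> Y a -> cts S a ->
  cts (fun b => mean f w (X b) (Y b) (S b)) a.
Proof.
move=> cf cw cX cY cS.
apply: (@box_cts _ _ _ (fun bz : T * 'rV[R]_d2 =>
    f (row_mx (X bz.1) (Y bz.1 + S bz.1 *: bz.2)) * w bz.2)) => /=.
  by move=> b z; exact: mean_cts_z.
move=> z; apply: (@integrand_cts _ f w (fun bz : T * 'rV[R]_d2 => X bz.1)
  (fun bz => Y bz.1) (fun bz => bz.2) (fun bz => S bz.1)) => //.
- by apply: (@cvg_comp _ _ _ fst X); [exact: cvg_fst|].
- by apply: (@cvg_comp _ _ _ fst Y); [exact: cvg_fst|].
- exact: cvg_snd.
- by apply: (@cvg_comp _ _ _ fst S); [exact: cvg_fst|].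
Qed.

Section Der.
Variables (f : 'rV[R]_(d1 + d2) -> R) (w : 'rV[R]_d2 -> R).
Hypotheses (Cf : C1 f) (cw : forall z, cts w z).

Let cf : forall p, cts f p. Proof. by case: Cf. Qed.
Let cdf i : forall p, cts (pderiv i f) p. Proof. by case: Cf => _ /(_ i)[]. Qed.

Lemma dder_y x y z : dder (fun y => f (row_mx x y)) z y (\sum_j z 0 j * dy j f (row_mx x y)).
Proof.
have := C1_dder (row_mx 0 z) (row_mx x y) Cf.
rewrite big_split_ord /= big1 ?add0r; last by move=> i _; rewrite row_mxEl mxE mul0r.
under eq_bigr do rewrite row_mxEr.
rewrite /dder; congr der; apply/funext => t.
by rewrite scale_row_mx add_row_mx scaler0 addr0.
Qed.

Lemma dder_x x y i : dder (fun x => f (row_mx x y)) (basisv R i) x (dx i f (row_mx x y)).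
Proof.
have [_ /(_ (lshift d2 i))[+ _]] := Cf => /(_ (row_mx x y)).
rewrite /dder; congr der; apply/funext => t; congr f.
apply/rowP => k; case: (split_ordP k) => j ->.
  by rewrite /basisv [LHS]mxE !row_mxEl [RHS]mxE; congr (_ + _); rewrite !mxE eq_lshift.
by rewrite /basisv [LHS]mxE !row_mxEr !mxE eq_rlshift andbF mulr0 addr0.
Qed.

Lemma dder_yj x y j : dder (fun y => f (row_mx x y)) (basisv R j) y (dy j f (row_mx x y)).
Proof.
apply: (der_eq (dder_y x y (basisv R j))).
rewrite (bigD1 j)//= big1 ?addr0 /basisv ?mxE ?eqxx ?mul1r// => k kj.
by rewrite mxE (negbTE kj) andbF mul0r.
Qed.

Lemma mean_der_s x y s : der (fun s => mean f w x y s) s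
  (\sum_j mean (dy j f) (fun z => z 0 j * w z) x y s).
Proof.
pose F' t z := (\sum_j z 0 j * dy j f (row_mx x (y + t *: z))) * w z.
have cwj j z : cts (fun z => z 0 j * w z) z by apply: ctsM; [exact: cts_coord|exact: cw].
suff <- : box (F' s) = \sum_j mean (dy j f) (fun z => z 0 j * w z) x y s.
  apply: (@box_der _ _ (fun t z => f (row_mx x (y + t *: z)) * w z) F' s 1) => //.
  - by move=> t z; exact: mean_cts_z.
  - move=> t z _; rewrite -[F' t z]addr0 -(mulr0 (f (row_mx x (y + t *: z)))).
    apply: derM; last exact: der_cst.
    exact: (@dder_line _ _ (fun y => f (row_mx x y)) _ z y t (fun q => dder_y x q z)).
  - move=> z; rewrite /F'; under [X in cts X]eq_fun do rewrite mulr_suml.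
    apply: cts_sum => j; under [X in cts X]eq_fun do rewrite mulrAC mulrC.
    apply: (@integrand_cts _ (dy j f) (fun z => z 0 j * w z) (fun=> x) (fun=> y) snd fst);
    by [exact: cdf|exact: cwj|exact: cvgT_cst|exact: cvg_snd|exact: cvg_fst].
rewrite -box_sum; last by move=> j z; apply: mean_cts_z; [exact: cdf|exact: cwj].
congr box; apply/funext => z; rewrite /F' mulr_suml; apply: eq_bigr => j _.
by rewrite mulrAC mulrC.
Qed.

Lemma mean_dder_x x y s i :
  dder (fun x => mean f w x y s) (basisv R i) x (mean (dx i f) w x y s).
Proof.
pose F' t z := dx i f (row_mx (x + t *: basisv R i) (y + s *: z)) * w z.
apply: (@der_eq _ _ _ (box (F' 0))); last first.
  by congr box; apply/funext => z; rewrite /F' scale0r addr0.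
apply: (@box_der _ _ (fun t z => f (row_mx (x + t *: basisv R i) (y + s *: z)) * w z) F' 0 1) => //.
- by move=> t z; exact: mean_cts_z.
- move=> t z _; rewrite -[F' t z]addr0.
  rewrite -(mulr0 (f (row_mx (x + t *: basisv R i) (y + s *: z)))).
  apply: derM; last exact: der_cst.
  exact: (@dder_line _ _ (fun x => f (row_mx x (y + s *: z))) _ (basisv R i) x t (fun q => dder_x q _ i)).
move=> z; apply: (@integrand_cts _ (dx i f) w (fun tz : R * 'rV[R]_d2 => x + tz.1 *: basisv R i)
  (fun=> y) snd (fun=> s)) => //; try by [exact: cdf|exact: cvgT_cst|exact: cvg_snd|exact: cts_cst].
by apply: cvgD; [exact: cvgT_cst|apply: cvgZr_tmp; exact: cvg_fst].
Qed.

Lemma mean_dder_y x y s j :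
  dder (fun y => mean f w x y s) (basisv R j) y (mean (dy j f) w x y s).
Proof.
pose F' t z := dy j f (row_mx x (y + t *: basisv R j + s *: z)) * w z.
apply: (@der_eq _ _ _ (box (F' 0))); last first.
  by congr box; apply/funext => z; rewrite /F' scale0r addr0.
apply: (@box_der _ _ (fun t z => f (row_mx x (y + t *: basisv R j + s *: z)) * w z) F' 0 1) => //.
- by move=> t z; exact: mean_cts_z.
- move=> t z _; rewrite -[F' t z]addr0.
  rewrite -(mulr0 (f (row_mx x (y + t *: basisv R j + s *: z)))).
  apply: derM; last exact: der_cst.
  have := @dder_line _ _ (fun y => f (row_mx x y)) _ (basisv R j) (y + s *: z) t
    (fun q => dder_yj x q j).
  by rewrite [y + t *: _ + _]addrAC; congr der; apply/funext => r; rewrite addrAC.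
move=> z; apply: (@integrand_cts _ (dy j f) w (fun=> x)
  (fun tz : R * 'rV[R]_d2 => y + tz.1 *: basisv R j) snd (fun=> s)) => //;
  try by [exact: cdf|exact: cvgT_cst|exact: cvg_snd|exact: cts_cst].
by apply: cvgD; [exact: cvgT_cst|apply: cvgZr_tmp; exact: cvg_fst].
Qed.

(** The left side is the integral of the z_j-derivative of f(x, y + s z) w(z); the factor [s] is the
    inner derivative of y + s z. *)
Lemma mean_parts (w' : 'rV[R]_d2 -> R) j x y s :
  (forall z, cts w' z) -> (forall z, dder w (basisv R j) z (w' z)) ->
  (forall z, inbox z -> `|z 0 j| = 1 -> w z = 0) ->
  s * mean (dy j f) w x y s + mean f w' x y s = 0.
Proof.
move=> cw' dw w0.
have c1 := @mean_cts_z _ w x y s (@cdf (rshift d1 j)) cw.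
have c2 := @mean_cts_z _ w' x y s cf cw'.
rewrite /mean -boxZ// -boxD//; last by move=> z; apply: ctsM; [exact: cts_cst|exact: c1].
apply: (@box_div _ _ j (fun z => f (row_mx x (y + s *: z)) * w z)).
- exact: mean_cts_z.
- by move=> z; apply: ctsD; [apply: ctsM; [exact: cts_cst|exact: c1]|exact: c2].
- move=> z; have H : dder (fun z => f (row_mx x (y + s *: z))) (basisv R j) z
      (s * dy j f (row_mx x (y + s *: z))).
    have := dder_y x (y + s *: z) (s *: basisv R j).
    rewrite (bigD1 j)//= big1 ?addr0 /basisv; last first.
      by move=> k kj; rewrite !mxE (negbTE kj) andbF mulr0 mul0r.
    rewrite !mxE !eqxx mulr1 /dder; congr der; apply/funext => t.
    by rewrite scalerDr !scalerA addrA [t * s]mulrC.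
  apply: (der_eq (derM H (dw z))); rewrite scale0r addr0.
  by rewrite mulrA.
- by move=> z z1 zj; rewrite w0// mulr0.
Qed.

End Der.

Lemma mean_sum (I : Type) (r : seq I) (P : pred I) f (W : I -> 'rV[R]_d2 -> R) x y s :
  (forall p, cts f p) -> (forall i z, cts (W i) z) ->
  mean f (fun z => \sum_(i <- r | P i) W i z) x y s = \sum_(i <- r | P i) mean f (W i) x y s.
Proof.
move=> cf cW; rewrite /mean -box_sum; last by move=> i; exact: mean_cts_z.
by congr box; apply/funext => z; rewrite mulr_sumr.
Qed.

Lemma meanZ a f w x y s : (forall p, cts f p) -> (forall z, cts w z) ->
  mean f (fun z => a * w z) x y s = a * mean f w x y s.
Proof.
move=> cf cw; rewrite /mean -boxZ; last exact: mean_cts_z.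
by congr box; apply/funext => z; rewrite mulrCA.
Qed.

Lemma meanD f w v x y s : (forall p, cts f p) -> (forall z, cts w z) -> (forall z, cts v z) ->
  mean f (fun z => w z + v z) x y s = mean f w x y s + mean f v x y s.
Proof.
move=> cf cw cv; rewrite /mean -boxD; [|exact: mean_cts_z|exact: mean_cts_z].
by congr box; apply/funext => z; rewrite mulrDr.
Qed.

End Mean.

(** * The damped wave equation satisfied by the means *)

Section Pde.
Variables (R : realType) (d1 d2 m : nat).
Implicit Types (f : 'rV[R]_(d1 + d2) -> R) (w : 'rV[R]_d2 -> R)
  (x : 'rV[R]_d1) (y z : 'rV[R]_d2) (s : R).

Notation kappa := (@ker R d2 m.+2).

(** The coefficient b for the kernel of exponent [m.+2]: the part [2 * m.+2%:R] comes from the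
    gradient of the kernel, 1 + d2 from the divergence of e_j - z_j z, which is -(d2 + 1) z_j. *)
Definition dampc : R := 2 * m.+2%:R + 1 + d2%:R.

Lemma sum_delta d (a : 'I_d -> R) j : \sum_k (j == k)%:R * a k = a j.
Proof.
rewrite (bigD1 j)//= eqxx mul1r big1 ?addr0// => k kj.
by rewrite eq_sym (negbTE kj) mul0r.
Qed.

(* The vector field is kappa th (e_j - z_j z): since grad kappa is parallel to z,
   its divergence contains no kernel of lower order than kappa. *)
Lemma mean_div f (th : 'rV[R]_d2 -> R) (dth : 'I_d2 -> 'rV[R]_d2 -> R) j x y s : C1 f ->
  (forall z, cts th z) -> (forall k z, cts (dth k) z) ->
  (forall k z, dder th (basisv R k) z (dth k z)) ->
  s * mean (dy j f) (fun z => th z * kappa z) x y s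
   + mean f (fun z => kappa z * (dth j z - z 0 j * \sum_k z 0 k * dth k z)) x y s =
  s * (\sum_k mean (dy k f) (fun z => z 0 k * (z 0 j * (th z * kappa z))) x y s)
   + dampc * mean f (fun z => z 0 j * (th z * kappa z)) x y s.
Proof.
move=> Cf cth cdth hth.
have cf : forall p, cts f p by case: Cf.
have cdf k : forall p, cts (dy k f) p by case: Cf => _ /(_ (rshift d1 k))[].
have ck n z : cts (@ker R d2 n) z by exact: ker_cts.
pose W k z := kappa z * ((j == k)%:R - z 0 j * z 0 k) * th z.
pose W' k z := (- (2 * m.+2%:R) * z 0 k * ker m.+1 z * ((j == k)%:R - z 0 j * z 0 k)
   - kappa z * ((j == k)%:R * z 0 k + z 0 j)) * th z
   + kappa z * ((j == k)%:R - z 0 j * z 0 k) * dth k z.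
have cW k z : cts (W k) z by rewrite /W; ctk.
have cW' k z : cts (W' k) z by rewrite /W'; ctk.
have dW k z : dder (W k) (basisv R k) z (W' k z).
  have h := derM (derM (ker_dder m k z)
    (derB (der_cst ((j == k)%:R) 0) (derM (coord_dder j k z) (coord_dder k k z)))) (hth k z).
  apply: (der_eq h); rewrite /= scale0r addr0 /W' eqxx mulr1; ring.
have P k : s * mean (dy k f) (W k) x y s + mean f (W' k) x y s = 0.
  apply: mean_parts => // z _ zk; by rewrite /W (ker_bd _ zk) !mul0r.
have : \sum_k (s * mean (dy k f) (W k) x y s + mean f (W' k) x y s) = 0 by rewrite big1.
rewrite big_split /= -mulr_sumr -mean_sum//.
have -> : \sum_k mean (dy k f) (W k) x y s =
    mean (dy j f) (fun z => th z * kappa z) x y s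
    - \sum_k mean (dy k f) (fun z => z 0 k * (z 0 j * (th z * kappa z))) x y s.
  rewrite -(@sum_delta d2 (fun k => mean (dy k f) (fun z => th z * kappa z) x y s) j).
  rewrite -sumrB; apply: eq_bigr => k _.
  rewrite -mulN1r -!meanZ//; try by move=> *; ctk.
  rewrite -meanD//; try by move=> *; ctk.
  by congr mean; apply/funext => z; rewrite /W; ring.
(* In the divergence, grad kappa applied to e_j - z_j z leaves the factor 1 - |z|^2, which raises
   [ker m.+1] back to [kappa] by [kerS]. *)
have -> : (fun z => \sum_k W' k z) = fun z =>
   kappa z * (dth j z - z 0 j * \sum_k z 0 k * dth k z)
   + - dampc * (z 0 j * (th z * kappa z)).
  apply/funext => z.
  under eq_bigr => k _.
    rewrite (_ : W' k z = (- (2 * m.+2%:R) * ker m.+1 z * th z - kappa z * th z) * ((j == k)%:R * z 0 k)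
      + (2 * m.+2%:R) * z 0 j * ker m.+1 z * th z * z 0 k ^+ 2
      + kappa z * ((j == k)%:R * dth k z)
      + - (kappa z * z 0 j) * (z 0 k * dth k z)
      + - (kappa z * z 0 j * th z)); last by rewrite /W'; ring.
    over.
  rewrite !big_split /= -!mulr_sumr !sum_delta sumr_const card_ord -/(sqn z) -mulr_natr.
  rewrite /dampc (kerS m z); ring.
rewrite meanD//; try by move=> *; ctk.
rewrite meanZ//; last by move=> z; ctk.
lra.
Qed.

Definition C2dder f := C1 f /\ forall i, C1 (pderiv i f).

Variable (u : 'rV[R]_(d1 + d2) -> R).
Hypothesis Cu : C2dder u.

Let C1y j : C1 (dy j u). Proof. exact: (proj2 Cu). Qed.

Lemma mean_div1 f j x y s : C1 f ->
  s * mean (dy j f) kappa x y s =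
  s * (\sum_k mean (dy k f) (fun z => z 0 k * (z 0 j * kappa z)) x y s)
   + dampc * mean f (fun z => z 0 j * kappa z) x y s.
Proof.
move=> Cf; have cf : forall p, cts f p by case: Cf.
have := @mean_div f (fun=> 1) (fun=> fun=> 0) j x y s Cf.
have c0 (c : R) (z : 'rV[R]_d2) : cts (fun=> c) z by exact: cts_cst.
move=> /(_ (fun z => c0 1 z) (fun k z => c0 0 z) (fun k z => der_cst _ _)).
have -> : mean f (fun z => kappa z * (0 - z 0 j * \sum_(k < d2) z 0 k * 0)) x y s = 0.
  rewrite /mean -[RHS](box0 R d2); congr box; apply/funext => z.
  by rewrite big1 ?mulr0 ?subrr ?mulr0// => k _; rewrite mulr0.
rewrite addr0.
have E : (fun z => 1 * kappa z) = kappa by apply/funext => z; rewrite mul1r.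
under [X in s * X + _]eq_bigr do under eq_fun do rewrite mul1r.
under [X in mean f X]eq_fun do rewrite mul1r.
by rewrite E.
Qed.

(** With h the mean of [u], [mean_der_s] identifies the last sum as h_s and the double sum as h_ss,
    so this is s times the mean of Delta_y u written as s h_ss + b h_s. *)
Lemma mean_pde x y s :
  s * (\sum_j mean (dy j (dy j u)) kappa x y s) =
  s * (\sum_j \sum_k mean (dy k (dy j u)) (fun z => z 0 k * (z 0 j * kappa z)) x y s)
   + dampc * (\sum_j mean (dy j u) (fun z => z 0 j * kappa z) x y s).
Proof.
rewrite !mulr_sumr -big_split /=; apply: eq_bigr => j _.
exact: mean_div1.
Qed.

Variable o : 'I_d2.
Notation kappao := (fun z : 'rV[R]_d2 => z 0 o * kappa z).

(** Compared with [mean_pde], the weight z_o contributes its gradient e_o, which gives the extra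
    mean of [dy o u], and by Euler's identity one more copy of z_o, which raises the damping
    constant by 1. *)
Lemma mean_pdeo x y s :
  s * (\sum_j mean (dy j (dy j u)) kappao x y s) + mean (dy o u) kappa x y s =
  s * (\sum_j \sum_k mean (dy k (dy j u)) (fun z => z 0 k * (z 0 j * kappao z)) x y s)
   + (dampc + 1) * (\sum_j mean (dy j u) (fun z => z 0 j * kappao z) x y s).
Proof.
have ck n z : cts (@ker R d2 n) z by exact: ker_cts.
have cy j : forall p, cts (dy j u) p by case: (C1y j).
have H j : s * mean (dy j (dy j u)) kappao x y s + (o == j)%:R * mean (dy j u) kappa x y s =
   s * (\sum_k mean (dy k (dy j u)) (fun z => z 0 k * (z 0 j * kappao z)) x y s)
   + (dampc + 1) * (mean (dy j u) (fun z => z 0 j * kappao z) x y s).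
  have := @mean_div (dy j u) (fun z => z 0 o) (fun k _ => (o == k)%:R) j x y s (C1y j).
  have c1 z : cts (fun z : 'rV[R]_d2 => z 0 o) z by ctk.
  have c2 k z : cts (fun _ : 'rV[R]_d2 => (o == k)%:R : R) z by ctk.
  move=> /(_ c1 c2 (fun k z => coord_dder o k z)).
  have -> : (fun z : 'rV[R]_d2 => kappa z * ((o == j)%:R - z 0 j * \sum_k z 0 k * (o == k)%:R)) =
    fun z => (o == j)%:R * kappa z + -1 * (z 0 j * kappao z).
    apply/funext => z; under eq_bigr do rewrite mulrC.
    by rewrite sum_delta; ring.
  rewrite meanD ?meanZ//; try by move=> *; ctk.
  lra.
rewrite -(@sum_delta d2 (fun j => mean (dy j u) kappa x y s) o).
rewrite !mulr_sumr -!big_split /=; apply: eq_bigr => j _; exact: H.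
Qed.

End Pde.

(** * Energy estimate *)

Section Energy.
Variables (R : realType) (d : nat).
Implicit Types (x : 'rV[R]_d) (s : R).

Definition ctsx (h : 'rV[R]_d -> R -> R) s x := cts (fun q : R * 'rV[R]_d => h q.2 q.1) (s, x).

Lemma ctsx_r (h : 'rV[R]_d -> R -> R) s x : ctsx h s x -> cts (h^~ s) x.
Proof.
move=> ch; apply: (@cts_comp _ _ _ (fun q : R * 'rV[R]_d => h q.2 q.1) (fun x => (s, x)) x) => //.
by apply: (@cvg_pairT _ _ _ (fun=> s) id x); [exact: cts_cst|exact: cvg_id].
Qed.

(** These functions stand for h_s, h_ss, h_i, h_is, h_ii; the energy involves only first derivatives
    of h. A single [his] serves as the s-derivative of [hi] and as the x_i-derivative of [hs]. *)
Variables (hs hss : 'rV[R]_d -> R -> R) (hi his hii : 'I_d -> 'rV[R]_d -> R -> R).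
Variables (x0 : 'rV[R]_d) (rho c : R).
Hypotheses (rho0 : 0 < rho) (c0 : 0 <= c).
Hypothesis inside : forall x, sqn (x - x0) < rho ^+ 2 -> forall k, `|x 0 k| < 1.
Hypotheses (chs : forall x s, ctsx hs s x) (chi : forall i x s, ctsx (hi i) s x).
Hypotheses (chss : forall x s, 0 < s -> ctsx hss s x)
  (chis : forall i x s, 0 < s -> ctsx (his i) s x)
  (chii : forall i x s, 0 < s -> ctsx (hii i) s x).
Hypotheses (dhs : forall x s, 0 < s -> der (hs x) s (hss x s))
  (dhi : forall i x s, 0 < s -> der (hi i x) s (his i x s))
  (dxhs : forall i x s, 0 < s -> dder (hs^~ s) (basisv R i) x (his i x s))
  (dxhi : forall i x s, 0 < s -> dder ((hi i)^~ s) (basisv R i) x (hii i x s)).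
Hypothesis pde : forall x s, 0 < s -> s * hss x s + c * hs x s = s * \sum_i hii i x s.
Hypotheses (hs0 : forall x, sqn (x - x0) < rho ^+ 2 -> hs x 0 = 0)
  (hi0 : forall i x, sqn (x - x0) < rho ^+ 2 -> hi i x 0 = 0).

(** [A] is positive, for s < rho, exactly inside the backward cone. Its truncated cube is a C^1
    cutoff that shrinks with the cone, so the energy can be integrated over the whole cube. *)
Let A x s := (rho - s) ^+ 2 - sqn (x - x0).
Let chi_ x s := pospow 3 (A x s).
Let e x s := hs x s ^+ 2 + \sum_i hi i x s ^+ 2.
Let E s := box (fun x => chi_ x s * e x s).
Let G s x := - (6 * (rho - s)) * pospow 2 (A x s) * e x s
  + chi_ x s * (2 * hs x s * hss x s + \sum_i 2 * hi i x s * his i x s).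

Lemma sqnB_cts x : cts (fun x => sqn (x - x0)) x.
Proof.
apply: cts_sum => k; apply: ctsX.
under [X in cts X]eq_fun do rewrite !mxE.
by apply: ctsB; [exact: cts_coord|exact: cts_cst].
Qed.

Lemma pospowA_cts m x s : ctsx (fun x s => pospow m (A x s)) s x.
Proof.
apply: (@cts_comp _ _ _ (pospow m) (fun q : R * 'rV[R]_d => A q.2 q.1)); first exact: pospow_cts.
change (cts (fun q : R * 'rV[R]_d => A q.2 q.1) (s, x)); rewrite /A; apply: ctsB.
  by apply: ctsX; apply: ctsB; [exact: cts_cst|exact: cvg_fst].
by apply: (@cts_comp _ _ _ (fun x => sqn (x - x0)) snd); [exact: sqnB_cts|exact: cvg_snd].
Qed.

Let e_cts x s : ctsx e s x.
Proof.
rewrite /ctsx /e; apply: ctsD; first by apply: ctsX; exact: chs.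
by apply: cts_sum => i; apply: ctsX; exact: chi.
Qed.

Let chie_cts x s : ctsx (fun x s => chi_ x s * e x s) s x.
Proof. by rewrite /ctsx; apply: ctsM; [exact: pospowA_cts|exact: e_cts]. Qed.

Let E_cts s : cts E s.
Proof.
apply: (@box_cts _ _ _ (fun q : R * 'rV[R]_d => chi_ q.2 q.1 * e q.2 q.1)) => /= [t x|x].
  exact: (@ctsx_r (fun x s => chi_ x s * e x s) t x).
exact: chie_cts.
Qed.

Let G_cts x s : 0 < s -> cts (fun q : R * 'rV[R]_d => G q.1 q.2) (s, x).
Proof.
move=> s0; rewrite /G; apply: ctsD.
  apply: ctsM; last exact: e_cts.
  apply: ctsM; last exact: pospowA_cts.
  by apply: ctsN; apply: ctsM; [exact: cts_cst|apply: ctsB; [exact: cts_cst|exact: cvg_fst]].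
apply: ctsM; first exact: pospowA_cts.
apply: ctsD.
  by apply: ctsM; [apply: ctsM; [exact: cts_cst|exact: chs]|exact: chss].
by apply: cts_sum => i; apply: ctsM; [apply: ctsM; [exact: cts_cst|exact: chi]|exact: chis].
Qed.

Let A_der x s : der (A x) s (- (2 * (rho - s))).
Proof.
have := derB (derXn 1 (derB (der_cst rho s) (der_id s))) (der_cst (sqn (x - x0)) s).
by move=> H; apply: (der_eq H); rewrite /= expr1; ring.
Qed.

Let chi_der x s : der (chi_ x) s (- (6 * (rho - s)) * pospow 2 (A x s)).
Proof.
by apply: (der_eq (der_comp (A_der x s) (pospow_der 1 (A x s)))); ring.
Qed.

Let E_der s : 0 < s -> der E s (box (G s)).
Proof.
move=> s0; apply: (@box_der _ _ (fun s x => chi_ x s * e x s) G s s) => //.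
- by move=> t x; exact: (@ctsx_r (fun x s => chi_ x s * e x s) t x).
- move=> t x ts; have t0 : 0 < t by move: ts; rewrite ltr_norml; lra.
  have h1 := derXn 1 (dhs x t0).
  have h2 : der (fun s => \sum_i hi i x s ^+ 2) t (\sum_i 2 * hi i x t * his i x t).
    apply: der_sum => i; have := derXn 1 (dhi i x t0); by rewrite expr1.
  apply: (der_eq (derM (chi_der x t) (derD h1 h2))).
  by rewrite expr1.
by move=> x; exact: G_cts.
Qed.

(** The flux chi h_s grad h. Its divergence integrates to zero; subtracting it twice from [G] trades
    the terms in [his] for terms in [hii], which the equation controls. *)
Let F i s x := chi_ x s * (hs x s * hi i x s).
Let F' i s x := - 6 * (x - x0) 0 i * pospow 2 (A x s) * (hs x s * hi i x s)
  + chi_ x s * (his i x s * hi i x s + hs x s * hii i x s).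

Let F_cts i s x : cts (F i s) x.
Proof.
rewrite /F; apply: ctsM; first exact: (@ctsx_r (fun x s => pospow 3 (A x s)) s x (@pospowA_cts 3 x s)).
have h1 : cts (hs^~ s) x by apply: ctsx_r; exact: chs.
have h2 : cts ((hi i)^~ s) x by apply: ctsx_r; exact: chi.
exact: ctsM.
Qed.

Let F'_cts i s x : 0 < s -> cts (F' i s) x.
Proof.
move=> s0.
have cA m := @ctsx_r (fun x s => pospow m (A x s)) s x (@pospowA_cts m x s).
have h1 : cts (hs^~ s) x by apply: ctsx_r; exact: chs.
have h2 : cts ((hi i)^~ s) x by apply: ctsx_r; exact: chi.
have h3 : cts ((his i)^~ s) x by apply: ctsx_r; exact: chis.
have h4 : cts ((hii i)^~ s) x by apply: ctsx_r; exact: chii.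
rewrite /F'; apply: ctsD.
  apply: ctsM; last exact: ctsM.
  apply: ctsM; last exact: cA.
  apply: ctsM; first exact: cts_cst.
  under [X in cts X]eq_fun do rewrite !mxE.
  by apply: ctsB; [exact: cts_coord|exact: cts_cst].
apply: ctsM; first exact: cA.
by apply: ctsD; exact: ctsM.
Qed.

Let F_dder i s x : 0 < s -> dder (F i s) (basisv R i) x (F' i s x).
Proof.
move=> s0.
have hA : dder (fun x => A x s) (basisv R i) x (- (2 * (x - x0) 0 i)).
  have h := derB (der_cst ((rho - s) ^+ 2) 0) (sqn_dder i (x - x0)).
  have := der_eq h (erefl _); rewrite sub0r /dder; congr der.
  by apply/funext => t; rewrite /A addrAC.
have hchi : dder (fun x => chi_ x s) (basisv R i) x (- 6 * (x - x0) 0 i * pospow 2 (A x s)).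
  apply: (der_eq (der_comp hA (pospow_der 1 _))).
  by rewrite scale0r addr0; ring.
apply: (der_eq (derM hchi (derM (dxhs i x s0) (dxhi i x s0)))).
by rewrite /= scale0r addr0.
Qed.

Let F_div i s : 0 < s -> s < rho -> box (F' i s) = 0.
Proof.
move=> s0 sr; apply: (@box_div _ _ i (F i s)) => //.
- by move=> x; exact: F'_cts.
- by move=> x; exact: F_dder.
move=> x _ xi; rewrite /F /chi_ pospow_npos ?mul0r//; rewrite leNgt; apply/negP => A0.
have : sqn (x - x0) < rho ^+ 2.
  apply: (@lt_trans _ _ ((rho - s) ^+ 2)); first by move: A0; rewrite /A; lra.
  by rewrite ltr_pXn2r ?nnegrE//; lra.
by move=> /inside /(_ i); rewrite xi ltxx.
Qed.

(** Two terms remain. The derivatives of the cutoff give -6 A_+^2 (r e - 2 h_s v . grad h),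
    nonpositive because |v| < r where A > 0: the cone has the propagation speed 1. The other carries
    the damping. *)
Let G_le0 s x : 0 < s -> s < rho -> G s x - 2 * \sum_i F' i s x <= 0.
Proof.
move=> s0 sr; pose v i := (x - x0) 0 i; pose r := rho - s.
have r0 : 0 < r by rewrite /r; lra.
have -> : G s x - 2 * \sum_i F' i s x =
    - 6 * pospow 2 (A x s) * (r * e x s - 2 * hs x s * \sum_i v i * hi i x s)
    + 2 * chi_ x s * hs x s * (hss x s - \sum_i hii i x s).
  have EF i : F' i s x = (- 6 * pospow 2 (A x s) * hs x s) * (v i * hi i x s)
      + chi_ x s * (hi i x s * his i x s) + chi_ x s * hs x s * hii i x s.
    by rewrite /F' /v; ring.
  rewrite (eq_bigr _ (fun i _ => EF i)) /G.
  under [X in chi_ x s * (_ + X)]eq_bigr do rewrite -mulrA.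
  by rewrite !big_split /= -!mulr_sumr /r; ring.
(* The equation leaves -(c / s) h_s; multiplied by h_s it has a sign, so the singular coefficient
   never has to be bounded. *)
have h1 : hss x s - \sum_i hii i x s = - (c / s) * hs x s.
  have s0' : s != 0 by rewrite gt_eqF.
  apply: (mulfI s0'); rewrite mulrBr -pde//; by field.
have h2 : 0 <= pospow 2 (A x s) * (r * e x s - 2 * hs x s * \sum_i v i * hi i x s).
  have [A0|A0] := leP (A x s) 0; first by rewrite pospow_npos// mul0r.
  apply: mulr_ge0; first exact: pospow_ge0.
  (* completing the square; A = r^2 - |v|^2 *)
  have -> : r * e x s - 2 * hs x s * (\sum_i v i * hi i x s) =
      r * \sum_i (hi i x s - hs x s / r * v i) ^+ 2 + hs x s ^+ 2 * A x s / r.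
    have EF i : (hi i x s - hs x s / r * v i) ^+ 2 = hi i x s ^+ 2
        + (- 2 * (hs x s / r)) * (v i * hi i x s) + (hs x s / r) ^+ 2 * v i ^+ 2 by ring.
    rewrite (eq_bigr _ (fun i _ => EF i)).
    rewrite !big_split /= -!mulr_sumr /e /A -/r (_ : sqn _ = \sum_i v i ^+ 2)//.
    by field; rewrite gt_eqF.
  apply: addr_ge0; first by apply: mulr_ge0; [exact: ltW|apply: sumr_ge0 => i _; exact: sqr_ge0].
  by apply: divr_ge0; [apply: mulr_ge0; [exact: sqr_ge0|exact: ltW]|exact: ltW].
have h3 : 0 <= chi_ x s * (c / s * hs x s ^+ 2).
  by rewrite mulr_ge0 ?pospow_ge0// mulr_ge0 ?sqr_ge0// divr_ge0// ltW.
rewrite h1 (_ : _ + _ = - 6 * (pospow 2 (A x s) * (r * e x s - 2 * hs x s * \sum_i v i * hi i x s))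
  - 2 * (chi_ x s * (c / s * hs x s ^+ 2))); last by ring.
lra.
Qed.

Let EG_le0 s : 0 < s -> s < rho -> box (G s) <= 0.
Proof.
move=> s0 sr.
have cG x : cts (G s) x.
  apply: (@cts_comp _ _ _ (fun q : R * 'rV[R]_d => G q.1 q.2) (fun x => (s, x)) x); first exact: G_cts.
  by apply: (@cvg_pairT _ _ _ (fun=> s) id x); [exact: cts_cst|exact: cvg_id].
have cF x : cts (fun x => 2 * \sum_i F' i s x) x.
  by apply: ctsM; [exact: cts_cst|apply: cts_sum => i; exact: F'_cts].
have : box (fun x => G s x - 2 * \sum_i F' i s x) <= 0.
  rewrite -[leRHS](box0 R d); apply: box_le => //.
  - by move=> x; apply: (@ctsB _ _ (G s) (fun x => 2 * \sum_i F' i s x)).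
  - by move=> x; exact: cts_cst.
  by move=> x _; exact: G_le0.
rewrite boxB// boxZ; last by move=> x; apply: cts_sum => i; exact: F'_cts.
rewrite box_sum; last by move=> i x; exact: F'_cts.
by rewrite big1 ?mulr0 ?subr0// => i _; exact: F_div.
Qed.

(** The energy is nonnegative, starts at 0 and does not increase, hence it vanishes; the cutoff is
    positive at the apex abscissa [x0], so h_s must be zero there. *)
Lemma energy s : 0 < s -> s < rho -> hs x0 s = 0.
Proof.
move=> s0 sr.
have sqn0 : sqn (x0 - x0) = 0.
  by rewrite subrr /sqn big1// => i _; rewrite mxE expr0n.
have E0 : E 0 = 0.
  rewrite -[RHS](box0 R d) /E; apply: box_eq => [x|x|x _].
  - exact: (@ctsx_r (fun x s => chi_ x s * e x s) 0 x).
  - exact: cts_cst.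
  have [h|h] := ltP (sqn (x - x0)) (rho ^+ 2).
    rewrite /e hs0// big1 ?expr0n ?addr0 ?mulr0// => i _.
    by rewrite hi0// expr0n.
  by rewrite /chi_ pospow_npos ?mul0r// /A subr0 subr_le0.
have [t _|t /andP[t0 ts]|t /andP[t0 ts] Et] := @der_MVT _ E (fun s => box (G s)) 0 s s0.
- exact: E_cts.
- exact: E_der.
have Es : E s <= 0.
  move: Et; rewrite E0 !subr0 => ->; by apply: mulr_le0_ge0; [apply: EG_le0 => //; lra|exact: ltW].
apply/eqP; apply: contraTT Es => hx; rewrite -ltNge.
apply: (@box_gt0 _ _ _ x0).
- by move=> x; exact: (@ctsx_r (fun x s => chi_ x s * e x s) s x).
- move=> x _; rewrite mulr_ge0 ?pospow_ge0// addr_ge0 ?sqr_ge0// sumr_ge0// => i _.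
  exact: sqr_ge0.
- by move=> k; rewrite -ltr_norml; apply: inside; rewrite sqn0 exprn_gt0.
rewrite mulr_gt0//.
  by rewrite pospow_gt0// /A sqn0 subr0 exprn_gt0// subr_gt0.
rewrite ltr_pwDl ?sumr_ge0//; last by move=> i _; exact: sqr_ge0.
by rewrite lt_neqAle sqr_ge0 eq_sym sqrf_eq0 hx.
Qed.

End Energy.

(** * Vanishing of the even and odd means *)

Section Vanish.
Variables (R : realType) (d1 d2 : nat) (u : 'rV[R]_(d1 + d2) -> R).
Implicit Types (x : 'rV[R]_d1) (y z : 'rV[R]_d2) (s : R).
Hypothesis Cu : C2dder u.
Hypothesis wave : forall p, \sum_i dx i (dx i u) p = \sum_j dy j (dy j u) p.

Let Cu1 : C1 u. Proof. exact: (proj1 Cu). Qed.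
Let C1x i : C1 (dx i u). Proof. exact: (proj2 Cu). Qed.
Let C1y j : C1 (dy j u). Proof. exact: (proj2 Cu). Qed.
Let cu p : cts u p. Proof. exact: (proj1 Cu1). Qed.
Let cux i p : cts (dx i u) p. Proof. exact: (proj1 (C1x i)). Qed.
Let cuy j p : cts (dy j u) p. Proof. exact: (proj1 (C1y j)). Qed.
Let cuxx i k p : cts (dx k (dx i u)) p. Proof. exact: (proj2 (proj2 (C1x i) _)). Qed.
Let cuxy i j p : cts (dy j (dx i u)) p. Proof. exact: (proj2 (proj2 (C1x i) _)). Qed.
Let cuyx i j p : cts (dx i (dy j u)) p. Proof. exact: (proj2 (proj2 (C1y j) _)). Qed.
Let cuyy j k p : cts (dy k (dy j u)) p. Proof. exact: (proj2 (proj2 (C1y j) _)). Qed.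

(** The s-derivative of a mean of [dx i u] contains [dy j (dx i u)], the x_i-derivative of h_s
    contains [dx i (dy j u)]; [energy] needs one function for both. *)
Lemma dxdyC i j : dx i (dy j u) = dy j (dx i u).
Proof.
apply/funext => p.
apply: (@dder_sym _ _ u (dy j u) (dx i u) _ _ (basisv R (rshift d1 j)) (basisv R (lshift d2 i))).
- exact: (proj1 (proj2 Cu1 _)).
- exact: (proj1 (proj2 Cu1 _)).
- exact: (proj1 (proj2 (C1y j) _)).
- exact: (proj1 (proj2 (C1x i) _)).
- exact: cuyx.
- exact: cuxy.
Qed.

Lemma mean_wave (w : 'rV[R]_d2 -> R) x y s : (forall z, cts w z) ->
  \sum_i mean (dx i (dx i u)) w x y s = \sum_j mean (dy j (dy j u)) w x y s.
Proof.
move=> cw; rewrite /mean -!box_sum.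
- by congr box; apply/funext => z; rewrite -!mulr_suml wave.
- by move=> j; apply: mean_cts_z; [exact: cuyy|].
- by move=> i; apply: mean_cts_z; [exact: cuxx|].
Qed.

Lemma mean0 (f : 'rV[R]_(d1 + d2) -> R) (w : 'rV[R]_d2 -> R) x y :
  f (row_mx x y) = 0 -> mean f w x y 0 = 0.
Proof.
move=> f0; rewrite /mean -[RHS](box0 R d2); congr box; apply/funext => z.
by rewrite scale0r addr0 f0 mul0r.
Qed.

Lemma mean_ctsx (f : 'rV[R]_(d1 + d2) -> R) (w : 'rV[R]_d2 -> R) x y s :
  (forall p, cts f p) -> (forall z, cts w z) -> ctsx (fun x s => mean f w x y s) s x.
Proof.
move=> cf cw; apply: (@mean_cts _ _ _ _ f w snd (fun=> y) fst) => //.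
- exact: cvg_snd.
- exact: cvgT_cst.
- exact: cvg_fst.
Qed.

Lemma ctsx_sum d (I : Type) (r : seq I) (F : I -> 'rV[R]_d -> R -> R) s (x : 'rV[R]_d) :
  (forall i, ctsx (F i) s x) -> ctsx (fun (x : 'rV[R]_d) s => \sum_(i <- r) F i x s) s x.
Proof. by move=> cF; apply: cts_sum. Qed.

Variables (x0 : 'rV[R]_d1) (y0 : 'rV[R]_d2) (rho : R).
Hypotheses (inside : forall x, sqn (x - x0) < rho ^+ 2 -> forall k, `|x 0 k| < 1).
Hypotheses (u0 : forall x, sqn (x - x0) < rho ^+ 2 -> u (row_mx x y0) = 0)
  (ux0 : forall i x, sqn (x - x0) < rho ^+ 2 -> dx i u (row_mx x y0) = 0)
  (uy0 : forall j x, sqn (x - x0) < rho ^+ 2 -> dy j u (row_mx x y0) = 0).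

Let sqn00 s : 0 < s -> s < rho -> sqn (x0 - x0) < rho ^+ 2.
Proof.
move=> s0 sr; rewrite subrr /sqn big1 ?exprn_gt0//; first by lra.
by move=> i _; rewrite mxE expr0n.
Qed.

Let dampc_ge0 m : 0 <= dampc R d2 m.
Proof. by rewrite /dampc !addr_ge0// mulr_ge0. Qed.

(** [energy] gives h_s = 0 on the axis x = x0; h is then constant there and vanishes at s = 0, where
    it is a multiple of u (x0, y0). *)
Lemma mean_even m s : 0 < s -> s < rho -> mean u (ker m.+2) x0 y0 s = 0.
Proof.
move=> s0 sr.
pose k := @ker R d2 m.+2.
have ck z : cts k z by exact: ker_cts.
have ckj j z : cts (fun z => z 0 j * k z) z by apply: ctsM; [exact: cts_coord|exact: ck].
have ckk i j z : cts (fun z => z 0 i * (z 0 j * k z)) z.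
  by apply: ctsM; [exact: cts_coord|exact: ckj].
pose hs x s := \sum_j mean (dy j u) (fun z => z 0 j * k z) x y0 s.
have En t : 0 < t -> t < rho -> hs x0 t = 0.
  apply: (@energy R d1 hs
    (fun x s => \sum_j \sum_l mean (dy l (dy j u)) (fun z => z 0 l * (z 0 j * k z)) x y0 s)
    (fun i x s => mean (dx i u) k x y0 s)
    (fun i x s => \sum_j mean (dy j (dx i u)) (fun z => z 0 j * k z) x y0 s)
    (fun i x s => mean (dx i (dx i u)) k x y0 s) x0 rho (dampc R d2 m)) => //.
  - lra.
  - move=> x r; apply: ctsx_sum => j; apply: mean_ctsx; [exact: cuy|exact: ckj].
  - move=> i x r; apply: mean_ctsx; [exact: cux|exact: ck].
  - move=> x r _; apply: ctsx_sum => j; apply: ctsx_sum => l.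
    apply: mean_ctsx; [exact: cuyy|exact: ckk].
  - move=> i x r _; apply: ctsx_sum => j; apply: mean_ctsx; [exact: cuxy|exact: ckj].
  - move=> i x r _; apply: mean_ctsx; [exact: cuxx|exact: ck].
  - move=> x r _; apply: der_sum => j; apply: mean_der_s; [exact: C1y|exact: ckj].
  - move=> i x r _; apply: mean_der_s; [exact: C1x|exact: ck].
  - move=> i x r _; apply: der_sum => j; rewrite -dxdyC.
    apply: mean_dder_x; [exact: C1y|exact: ckj].
  - move=> i x r _; apply: mean_dder_x; [exact: C1x|exact: ck].
  - by move=> x r _; rewrite mean_wave//; apply/esym; exact: mean_pde.
  - by move=> x hx; apply: big1 => j _; apply: mean0; exact: uy0.
  - by move=> i x hx; apply: mean0; exact: ux0.
have [t _|t /andP[t0 ts]|t /andP[t0 ts]] :=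
    @der_MVT _ (fun s => mean u k x0 y0 s) (fun s => hs x0 s) 0 s s0.
- by apply: (@mean_cts _ _ _ _ u k (fun=> x0) (fun=> y0) id) => //;
    by [exact: cvgT_cst|exact: cvg_id].
- by apply: mean_der_s.
rewrite En// ?mul0r; last by lra.
by rewrite [mean _ _ _ _ 0]mean0 ?subr0// u0// (sqn00 s0).
Qed.

Variable o : 'I_d2.
Hypotheses (uxo0 : forall i x, sqn (x - x0) < rho ^+ 2 -> dx i (dy o u) (row_mx x y0) = 0)
  (uyo0 : forall j x, sqn (x - x0) < rho ^+ 2 -> dy j (dy o u) (row_mx x y0) = 0).

(* The mean L with weight z_o satisfies s L_ss + b L_s - (b / s) L = s Lap L; the
   quotient L / s satisfies the damped equation with b + 2 instead of b, and is, up
   to a constant, the mean of the derivative of u in y_o, hence C^1 up to s = 0.  Its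
   second derivatives are only available for s > 0, through L / s. *)
Lemma mean_odd m s : 0 < s -> s < rho ->
  mean u (fun z => z 0 o * ker m.+2 z) x0 y0 s = 0.
Proof.
move=> s0 sr.
pose k1 := @ker R d2 m.+3.
pose k z : R := z 0 o * @ker R d2 m.+2 z.
have ck1 z : cts k1 z by exact: ker_cts.
have ck1j j z : cts (fun z => z 0 j * k1 z) z by apply: ctsM; [exact: cts_coord|exact: ck1].
have ck z : cts k z by apply: ctsM; [exact: cts_coord|exact: ker_cts].
have ckj j z : cts (fun z => z 0 j * k z) z by apply: ctsM; [exact: cts_coord|exact: ck].
have ckk i j z : cts (fun z => z 0 i * (z 0 j * k z)) z.
  by apply: ctsM; [exact: cts_coord|exact: ckj].
(* The constant in the z_o-derivative of [k1], which is - c k; integration by parts then gives t M =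
   c L. *)
pose c : R := 2 * m.+3%:R.
have c0 : c != 0 by rewrite mulf_neq0// pnatr_eq0.
pose L x s := mean u k x y0 s.
pose Ls x s := \sum_j mean (dy j u) (fun z => z 0 j * k z) x y0 s.
pose Lss x s := \sum_j \sum_l mean (dy l (dy j u)) (fun z => z 0 l * (z 0 j * k z)) x y0 s.
pose Li i x s := mean (dx i u) k x y0 s.
pose Lis i x s := \sum_j mean (dy j (dx i u)) (fun z => z 0 j * k z) x y0 s.
pose Lii i x s := mean (dx i (dx i u)) k x y0 s.
pose M x s := mean (dy o u) k1 x y0 s.
pose Ms x s := \sum_j mean (dy j (dy o u)) (fun z => z 0 j * k1 z) x y0 s.
pose Mi i x s := mean (dx i (dy o u)) k1 x y0 s.
have ME x t : 0 < t -> M x t = c * (L x t / t).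
  move=> t0; have t0' : t != 0 by rewrite gt_eqF.
  have := @mean_parts _ _ _ u k1 Cu1 ck1 (fun z => - c * k z) o x y0 t.
  have ckc z : cts (fun z => - c * k z) z by apply: ctsM; [exact: cts_cst|exact: ck].
  have dk z : dder k1 (basisv R o) z (- c * k z).
    by apply: (der_eq (ker_dder m.+1 o z)); rewrite /c /k; ring.
  have bk z : inbox z -> `|z 0 o| = 1 -> k1 z = 0 by move=> _; exact: ker_bd.
  move=> /(_ ckc dk bk); rewrite meanZ// mulNr => /eqP; rewrite subr_eq0 => /eqP.
  rewrite -/(M x t) -/(L x t) => H; apply: (mulfI t0'); rewrite H.
  by field.
have dL x t : der (L x) t (Ls x t) by exact: mean_der_s.
have dLs x t : der (Ls x) t (Lss x t).
  by apply: der_sum => j; apply: mean_der_s; [exact: C1y|exact: ckj].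
have dLi i x t : der (Li i x) t (Lis i x t) by apply: mean_der_s; [exact: C1x|].
have dxL i x t : dder (L^~ t) (basisv R i) x (Li i x t) by exact: mean_dder_x.
have dxLs i x t : dder (Ls^~ t) (basisv R i) x (Lis i x t).
  by apply: der_sum => j; rewrite -dxdyC; apply: mean_dder_x; [exact: C1y|exact: ckj].
have dxLi i x t : dder ((Li i)^~ t) (basisv R i) x (Lii i x t).
  by apply: mean_dder_x; [exact: C1x|].
have dM x t : der (M x) t (Ms x t) by apply: mean_der_s; [exact: C1y|].
have dxM i x t : dder (M^~ t) (basisv R i) x (Mi i x t) by apply: mean_dder_x; [exact: C1y|].
(* The left side is continuous up to t = 0, the right side can be differentiated once more for t >
   0; uniqueness of the derivative identifies them. *)
have MsE x t : 0 < t -> Ms x t = c * (Ls x t / t - L x t / t ^+ 2).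
  move=> t0; have t0' : t != 0 by rewrite gt_eqF.
  apply: (der_uniq (dM x t)).
  apply: (@der_pos _ (fun t => c * (L x t / t)) _ t _ t0); first by move=> r r0; rewrite ME.
  by apply: (der_eq (derM (der_cst c t) (derM (dL x t) (derV t0')))); field.
have MiE i x t : 0 < t -> Mi i x t = c * (Li i x t / t).
  move=> t0; apply: (der_uniq (dxM i x t)).
  rewrite (_ : (fun r => M (x + r *: basisv R i) t) =
    fun r => c * (L (x + r *: basisv R i) t / t)); last first.
    by apply/funext => r; rewrite ME.
  apply: (der_eq (derM (der_cst c 0) (derM (dxL i x t) (der_cst t^-1 0)))).
  by rewrite mul0r add0r mulr0 addr0.
have cL x t : ctsx L t x by exact: mean_ctsx.
have cLs x t : ctsx Ls t x.
  by apply: ctsx_sum => j; apply: mean_ctsx; [exact: cuy|exact: ckj].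
have cLss x t : ctsx Lss t x.
  apply: ctsx_sum => j; apply: ctsx_sum => l; apply: mean_ctsx; [exact: cuyy|exact: ckk].
have cLi i x t : ctsx (Li i) t x by apply: mean_ctsx; [exact: cux|].
have cLis i x t : ctsx (Lis i) t x.
  by apply: ctsx_sum => j; apply: mean_ctsx; [exact: cuxy|exact: ckj].
have cLii i x t : ctsx (Lii i) t x by apply: mean_ctsx; [exact: cuxx|].
have cV x t : 0 < t -> cts (fun q : R * 'rV[R]_d1 => q.1^-1) (t, x).
  by move=> t0; apply: (@ctsV _ _ fst); [rewrite gt_eqF|exact: cvg_fst].
(* The damping [dampc R d2 m + 2] is [dampc R d2 m.+1], the constant belonging to the kernel [k1] of
   [M]. *)
have En t : 0 < t -> t < rho -> Ms x0 t = 0.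
  apply: (@energy R d1 Ms
    (fun x s => c * (Lss x s / s - 2 * (Ls x s * s^-1 ^+ 2) + 2 * (L x s * s^-1 ^+ 3)))
    Mi
    (fun i x s => c * (Lis i x s / s - Li i x s * s^-1 ^+ 2))
    (fun i x s => c * (Lii i x s / s)) x0 rho (dampc R d2 m + 2)) => //.
  - lra.
  - by rewrite addr_ge0.
  - move=> x r; apply: ctsx_sum => j; apply: mean_ctsx; [exact: (proj2 (proj2 (C1y o) _))|exact: ck1j].
  - move=> i x r; apply: mean_ctsx; [exact: cuyx|exact: ck1].
  - move=> x r r0; have cVr := cV x r r0; rewrite /ctsx.
    apply: ctsM; first exact: cts_cst.
    apply: ctsD; first apply: ctsB.
    + by apply: ctsM; [exact: cLss|].
    + by apply: ctsM; [exact: cts_cst|apply: ctsM; [exact: cLs|exact: ctsX]].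
    + by apply: ctsM; [exact: cts_cst|apply: ctsM; [exact: cL|exact: ctsX]].
  - move=> i x r r0; have cVr := cV x r r0; rewrite /ctsx.
    apply: ctsM; first exact: cts_cst.
    apply: ctsB; first by apply: ctsM; [exact: cLis|].
    by apply: ctsM; [exact: cLi|exact: ctsX].
  - move=> i x r r0; have cVr := cV x r r0; rewrite /ctsx.
    by apply: ctsM; [exact: cts_cst|apply: ctsM; [exact: cLii|]].
  - move=> x r r0; have r0' : r != 0 by rewrite gt_eqF.
    apply: (@der_pos _ (fun t => c * (Ls x t / t - L x t * t^-1 ^+ 2)) _ r _ r0).
      by move=> q q0; rewrite MsE// exprVn.
    have h := derM (der_cst c r) (derB (derM (dLs x r) (derV r0'))
      (derM (dL x r) (derXn 1 (derV r0')))).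
    by apply: (der_eq h); rewrite expr1; field.
  - move=> i x r r0; have r0' : r != 0 by rewrite gt_eqF.
    apply: (@der_pos _ (fun t => c * (Li i x t / t)) _ r _ r0); first by move=> q q0; rewrite MiE.
    by apply: (der_eq (derM (der_cst c r) (derM (dLi i x r) (derV r0')))); field.
  - move=> i x r r0; rewrite /dder.
    rewrite (_ : (fun t => Ms (x + t *: basisv R i) r) =
      fun t => c * (Ls (x + t *: basisv R i) r / r - L (x + t *: basisv R i) r * r^-1 ^+ 2)); last first.
      by apply/funext => q; rewrite MsE// exprVn.
    apply: (der_eq (derM (der_cst c 0) (derB (derM (dxLs i x r) (der_cst r^-1 0))
      (derM (dxL i x r) (der_cst (r^-1 ^+ 2) 0))))).
    by rewrite !mulr0 !addr0 mul0r add0r.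
  - move=> i x r r0; rewrite /dder.
    rewrite (_ : (fun t => Mi i (x + t *: basisv R i) r) =
      fun t => c * (Li i (x + t *: basisv R i) r / r)); last first.
      by apply/funext => q; rewrite MiE.
    apply: (der_eq (derM (der_cst c 0) (derM (dxLi i x r) (der_cst r^-1 0)))).
    by rewrite !mulr0 !addr0 mul0r add0r.
  - move=> x r r0; have r0' : r != 0 by rewrite gt_eqF.
    rewrite MsE// -!mulr_sumr -mulr_suml /Lii mean_wave//.
    set S := \sum_j _; pose P := mean (dy o u) (ker m.+2) x y0 r.
    (* [p1] is the equation of L with the lower-order mean [P]; [p2] expresses [P] by [Ls] and [L].
       Eliminating [P] closes the equation. *)
    have p1 : r * S + P = r * Lss x r + (dampc R d2 m + 1) * Ls x r by exact: mean_pdeo.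
    have p2 : r * P = r * Ls x r + dampc R d2 m * L x r by exact: mean_div1.
    have PE : P = Ls x r + dampc R d2 m * L x r / r.
      by apply: (mulfI r0'); rewrite p2; field.
    have SE : S = Lss x r + dampc R d2 m * (Ls x r / r - L x r / r ^+ 2).
      have -> : S = (r * S + P - P) / r by field.
      by rewrite p1 PE; field.
    by rewrite SE; field.
  - by move=> x hx; apply: big1 => j _; apply: mean0; exact: uyo0.
  - by move=> i x hx; apply: mean0; exact: uxo0.
have MT : M x0 s = 0.
  have [t _|t /andP[t0 ts]|t /andP[t0 ts]] :=
      @der_MVT _ (M x0) (Ms x0) 0 s s0.
  - by apply: (@mean_cts _ _ _ _ (dy o u) k1 (fun=> x0) (fun=> y0) id) => //;
      by [exact: cvgT_cst|exact: cvg_id].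
  - exact: dM.
  rewrite En// ?mul0r; last by lra.
  by rewrite [M _ 0]mean0 ?subr0// uy0// (sqn00 s0).
move: MT; rewrite ME// => /eqP; rewrite mulf_eq0 (negbTE c0) /= mulf_eq0 invr_eq0 (gt_eqF s0) orbF => /eqP.
exact.
Qed.

End Vanish.

(** * From vanishing means to vanishing moments *)

Section C1Closure.
Variables (R : realType) (n : nat).
Implicit Types f g : 'rV[R]_n -> R.

Lemma C1I f (df : 'I_n -> 'rV[R]_n -> R) :
  (forall p, cts f p) -> (forall i p, dder f (basisv R i) p (df i p)) ->
  (forall i p, cts (df i) p) -> C1 f.
Proof.
move=> cf hf cdf; split => // i.
have E p : pderiv i f p = df i p.
  have h := hf i p; suff d1 : derivable f p (basisv R i) by exact: (der_uniq (derivable_dder d1) h).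
  apply/derivable1P; case: h => + _.
  by under eq_fun do rewrite addrC.
have -> : pderiv i f = df i by apply/funext.
by split.
Qed.

Lemma C1_cst c : C1 (fun _ : 'rV[R]_n => c).
Proof.
apply: (@C1I _ (fun=> fun=> 0)) => [p|i p|i p]; first exact: cts_cst.
  exact: der_cst.
exact: cts_cst.
Qed.

Lemma C1_coord k : C1 (fun p : 'rV[R]_n => p 0 k).
Proof.
apply: (@C1I _ (fun i=> fun=> (k == i)%:R)) => [p|i p|i p]; first exact: cts_coord.
  exact: coord_dder.
exact: cts_cst.
Qed.

Lemma C1D f g : C1 f -> C1 g -> C1 (fun p => f p + g p).
Proof.
move=> [cf hf] [cg hg].
apply: (@C1I _ (fun i p => pderiv i f p + pderiv i g p)) => [p|i p|i p]; first exact: ctsD.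
  by apply: derD; [exact: (proj1 (hf i))|exact: (proj1 (hg i))].
by apply: ctsD; [exact: (proj2 (hf i))|exact: (proj2 (hg i))].
Qed.

Lemma C1M f g : C1 f -> C1 g -> C1 (fun p => f p * g p).
Proof.
move=> [cf hf] [cg hg].
apply: (@C1I _ (fun i p => pderiv i f p * g p + f p * pderiv i g p)) => [p|i p|i p].
- exact: ctsM.
- have := derM (proj1 (hf i) p) (proj1 (hg i) p).
  by rewrite scale0r addr0.
by apply: ctsD; apply: ctsM => //; [exact: (proj2 (hf i))|exact: (proj2 (hg i))].
Qed.

End C1Closure.

Section Moments.
Variables (R : realType) (d1 d2 : nat) (o : 'I_d2) (x0 : 'rV[R]_d1) (eta rho : R).
Implicit Types (f g : 'rV[R]_(d1 + d2) -> R) (y z : 'rV[R]_d2).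

(** All exponents and an open set of centres in the hyperplane are quantified over, because
    multiplication of [f] by y_j is achieved by differentiating in the centre and lowering the
    exponent by one. *)
Definition null_means f := forall m y s, y 0 o = 0 -> sqn y < eta -> 0 < s -> s < rho ->
  mean f (ker m.+2) x0 y s = 0.

Let yc j (p : 'rV[R]_(d1 + d2)) := p 0 (rshift d1 j).

Let C1yc j f : C1 f -> C1 (fun p => yc j p * f p).
Proof. by move=> Cf; exact: (C1M (C1_coord R (rshift d1 j)) Cf). Qed.

Lemma mean_coord f w j x y s : (forall p, cts f p) -> (forall z, cts w z) ->
  mean (fun p => yc j p * f p) w x y s = y 0 j * mean f w x y s + s * mean f (fun z => z 0 j * w z) x y s.
Proof.
move=> cf cw; have cw' z : cts (fun z => z 0 j * w z) z by apply: ctsM; [exact: cts_coord|exact: cw].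
rewrite -!meanZ// -meanD//; last 2 first.
- by move=> z; apply: ctsM; [exact: cts_cst|exact: cw].
- by move=> z; apply: ctsM; [exact: cts_cst|exact: cw'].
congr box; apply/funext => z; rewrite /yc row_mxEr !mxE; ring.
Qed.

(** The mean with exponent [m.+3] is zero for all nearby centres, so its derivative in y_j is zero,
    and integration by parts turns that into the weight z_j times the kernel of exponent [m.+2].
    With j != o the moving centre stays in the hyperplane. *)
Lemma null_means_z f j : C1 f -> null_means f -> j != o ->
  forall m y s, y 0 o = 0 -> sqn y < eta -> 0 < s -> s < rho ->
  mean f (fun z => z 0 j * ker m.+2 z) x0 y s = 0.
Proof.
move=> Cf nf jo m y s yo yeta s0 sr.
have ck n z : cts (@ker R d2 n) z by exact: ker_cts.
have ckj n z : cts (fun z => z 0 j * @ker R d2 n z) z by apply: ctsM; [exact: cts_coord|exact: ck].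
have d0 : mean (dy j f) (ker m.+3) x0 y s = 0.
  apply: (der_uniq (@mean_dder_y _ _ _ f (ker m.+3) Cf (ck m.+3) x0 y s j)).
  apply: (@der_near _ (fun=> 0)); last exact: der_cst.
  have csq : cts (fun t : R => sqn (y + t *: basisv R j)) 0.
    by apply: der_cts; exact: sqn_dder.
  have : \forall t \near (0 : R), sqn (y + t *: basisv R j) < eta.
    apply: (cvgr_lt _ csq); by rewrite scale0r addr0.
  apply: filterS => t yt; rewrite nf//.
  by rewrite /basisv !mxE (eq_sym o) (negbTE jo) andbF mulr0 addr0.
have := @mean_parts _ _ _ f (ker m.+3) Cf (ck _) (fun z => - (2 * m.+3%:R) * (z 0 j * ker m.+2 z)) j x0 y s.
have c1 z : cts (fun z => - (2 * m.+3%:R) * (z 0 j * @ker R d2 m.+2 z)) z.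
  by apply: ctsM; [exact: cts_cst|exact: ckj].
have c2 z : dder (@ker R d2 m.+3) (basisv R j) z (- (2 * m.+3%:R) * (z 0 j * ker m.+2 z)).
  by apply: (der_eq (ker_dder m.+1 j z)); ring.
have c3 z : inbox z -> `|z 0 j| = 1 -> @ker R d2 m.+3 z = 0 by move=> _; exact: ker_bd.
move=> /(_ c1 c2 c3); rewrite d0 mulr0 add0r meanZ//; last exact: (proj1 Cf).
move/eqP; rewrite mulf_eq0 oppr_eq0 => /orP[|/eqP//].
by rewrite mulf_eq0 !pnatr_eq0.
Qed.

Lemma null_means_coord f j : C1 f -> null_means f -> j != o -> null_means (fun p => yc j p * f p).
Proof.
move=> Cf nf jo m y s yo yeta s0 sr.
rewrite mean_coord; [|exact: (proj1 Cf)|by move=> z; exact: ker_cts].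
by rewrite nf// null_means_z// !mulr0 addr0.
Qed.

(** At centres with y_o = 0 the factor is s^2 z_o^2. Here z_o^2 is |z|^2 minus the other squares; by
    [kerS], |z|^2 times a kernel is a difference of two kernels. *)
Lemma null_means_oo f : C1 f -> null_means f -> null_means (fun p => yc o p * f p) ->
  null_means (fun p => yc o p * (yc o p * f p)).
Proof.
move=> Cf nf nof m y s yo yeta s0 sr.
have cf := proj1 Cf.
have ck n z : cts (@ker R d2 n) z by exact: ker_cts.
have ckj j n z : cts (fun z => z 0 j * @ker R d2 n z) z by apply: ctsM; [exact: cts_coord|exact: ck].
have ckjj j n z : cts (fun z => z 0 j * (z 0 j * @ker R d2 n z)) z by apply: ctsM; [exact: cts_coord|exact: ckj].
have cof : forall p, cts (fun p => yc o p * f p) p by move=> p; apply: ctsM; [exact: cts_coord|exact: cf].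
rewrite mean_coord// yo mul0r add0r mean_coord// yo mul0r add0r.
have -> : (fun z => z 0 o * (z 0 o * @ker R d2 m.+2 z)) =
  fun z => (ker m.+2 z + -1 * ker m.+3 z) + -1 * (\sum_(j | j != o) z 0 j * (z 0 j * ker m.+2 z)).
  apply/funext => z; rewrite (kerS m.+1 z).
  have -> : \sum_(j | j != o) z 0 j * (z 0 j * ker m.+2 z) = (sqn z - z 0 o ^+ 2) * ker m.+2 z.
    rewrite /sqn [in RHS](bigD1 o)//= addrAC subrr add0r mulr_suml; apply: eq_bigr => j _.
    by ring.
  ring.
have cs z : cts (fun z : 'rV[R]_d2 => \sum_(j | j != o) z 0 j * (z 0 j * ker m.+2 z)) z.
  by apply: cts_sum => j.
have c1 n z : cts (fun z => -1 * @ker R d2 n z) z by apply: ctsM; [exact: cts_cst|exact: ck].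
have c2 z : cts (fun z => @ker R d2 m.+2 z + -1 * @ker R d2 m.+3 z) z by apply: ctsD; [exact: ck|exact: c1].
have c3 z : cts (fun z : 'rV[R]_d2 => -1 * \sum_(j | j != o) z 0 j * (z 0 j * ker m.+2 z)) z.
  by apply: ctsM; [exact: cts_cst|exact: cs].
rewrite meanD// meanD// !meanZ// mean_sum// !nf// big1; first by ring.
move=> j jo.
(* The weight z_j^2 on [f] is obtained from the weight z_j on y_j f, expanded by [mean_coord] and
   divided by s. *)
have C1j := C1yc j Cf.
have := @null_means_z _ j C1j (null_means_coord Cf nf jo) jo m y s yo yeta s0 sr.
rewrite mean_coord// null_means_z// mulr0 add0r => /eqP.
by rewrite mulf_eq0 (gt_eqF s0) /= => /eqP.
Qed.

(** The invariant stable under every y_j. The step to y_o^2 f relies on both f and y_o f; for f = u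
    the latter is what [mean_odd] provides. *)
Definition null2 f := [/\ C1 f, null_means f & null_means (fun p => yc o p * f p)].

Lemma null2_coord f j : null2 f -> null2 (fun p => yc j p * f p).
Proof.
move=> [Cf nf nof].
have Cj i := C1yc i Cf.
have [->|jo] := eqVneq j o; first by split => //; exact: null_means_oo.
split => //; first exact: null_means_coord.
have -> : (fun p => yc o p * (yc j p * f p)) = fun p => yc j p * (yc o p * f p).
  by apply/funext => p; rewrite mulrCA.
exact: null_means_coord.
Qed.

Lemma null_means_lin a f g : C1 f -> C1 g -> null_means f -> null_means g ->
  null_means (fun p => a * f p + g p).
Proof.
move=> [cf _] [cg _] nf ng m y s yo yeta s0 sr.
have ck z : cts (@ker R d2 m.+2) z by exact: ker_cts.
have := nf m y s yo yeta s0 sr; have := ng m y s yo yeta s0 sr; rewrite /mean => h1 h2.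
rewrite (_ : (fun z => _) = fun z => a * (f (row_mx x0 (y + s *: z)) * ker m.+2 z)
  + g (row_mx x0 (y + s *: z)) * ker m.+2 z); last by apply/funext => z; ring.
rewrite box_lin ?h1 ?h2 ?mulr0 ?addr0//; exact: mean_cts_z.
Qed.

Lemma null2_lin a f g : null2 f -> null2 g -> null2 (fun p => a * f p + g p).
Proof.
move=> [Cf nf nof] [Cg ng nog].
split.
- exact: (C1D (C1M (@C1_cst R _ a) Cf) Cg).
- exact: null_means_lin.
- rewrite (_ : (fun p => _) = fun p => a * (yc o p * f p) + yc o p * g p); last first.
    by apply/funext => p; ring.
  exact: (null_means_lin a (C1yc o Cf) (C1yc o Cg) nof nog).
Qed.

Definition paraboloid a (y : 'rV[R]_d2) (p : 'rV[R]_(d1 + d2)) : R := 1 - a * sqn (rsubmx p - y).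

Lemma null2_paraboloid a y f : null2 f -> null2 (fun p => paraboloid a y p * f p).
Proof.
move=> nf.
have nsub j g : null2 g -> null2 (fun p => (yc j p - y 0 j) * g p).
  move=> ng; rewrite (_ : (fun p => _) = fun p => - y 0 j * g p + yc j p * g p); last first.
    by apply/funext => p; ring.
  by apply: null2_lin => //; exact: null2_coord.
have nsum (r : seq 'I_d2) : null2 (fun p => - a * (\sum_(j <- r) (yc j p - y 0 j) ^+ 2 * f p) + f p).
  elim: r => [|j r ih].
    rewrite (_ : (fun p => _) = f)//.
    by apply/funext => p; rewrite big_nil mulr0 add0r.
  rewrite (_ : (fun p => _) = fun p => - a * ((yc j p - y 0 j) * ((yc j p - y 0 j) * f p)) +
    (- a * (\sum_(j <- r) (yc j p - y 0 j) ^+ 2 * f p) + f p)); last first.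
    by apply/funext => p; rewrite big_cons; ring.
  by apply: null2_lin => //; exact/nsub/nsub.
rewrite (_ : (fun p => _) = fun p => - a * (\sum_j (yc j p - y 0 j) ^+ 2 * f p) + f p)//.
apply/funext => p; rewrite /paraboloid /sqn -mulr_suml.
under eq_bigr do rewrite !mxE.
by rewrite /yc; ring.
Qed.

Lemma null2_paraboloidX a y f N : null2 f -> null2 (fun p => paraboloid a y p ^+ N * f p).
Proof.
move=> nf; elim: N => [|N ih].
  by rewrite (_ : (fun p => _) = f)//; apply/funext => p; rewrite expr0 mul1r.
rewrite (_ : (fun p => _) = fun p => paraboloid a y p * (paraboloid a y p ^+ N * f p)).
  exact: null2_paraboloid.
by apply/funext => p; rewrite exprS mulrA.
Qed.

End Moments.

(** * Concentration at a point *)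

Section Peak.
Variables (R : realType) (d : nat).
Implicit Types (g : 'rV[R]_d -> R) (z p : 'rV[R]_d).

(* Small enough for 1 - peakc |z - p|^2 to be nonnegative on the cube. *)
Definition peakc : R := (4 * d%:R + 2)^-1.

Lemma coord_le_sqn z k : z 0 k ^+ 2 <= sqn z.
Proof. by rewrite /sqn (bigD1 k)//= lerDl sumr_ge0// => i _; exact: sqr_ge0. Qed.

Lemma coord_lt_sqn z k r : 0 < r -> sqn z < r ^+ 2 -> `|z 0 k| < r.
Proof.
move=> r0 zr; have := le_lt_trans (coord_le_sqn z k) zr.
by rewrite ltr_norml => h; apply/andP; split; nra.
Qed.

Lemma sqn_ge0 z : 0 <= sqn z.
Proof. by apply: sumr_ge0 => i _; exact: sqr_ge0. Qed.

Lemma peakc_gt0 : 0 < peakc.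
Proof. by rewrite invr_gt0 ltr_wpDl// mulr_ge0. Qed.

(** The summand 2 in [peakc] keeps this strict even for d = 0; with r <= 1 it makes [t2] in
    [peak_pos] positive. *)
Lemma peakc_lt1 : peakc < 1.
Proof.
have d0 : 0 <= (d%:R : R) by [].
rewrite invf_lt1; [lra|by rewrite ltr_wpDl// mulr_ge0].
Qed.

Lemma peak_ge0 z p : inbox z -> inbox p -> 0 <= 1 - peakc * sqn (z - p).
Proof.
move=> hz hp; rewrite subr_ge0 /peakc mulrC ler_pdivrMr ?mul1r; last first.
  by rewrite ltr_wpDl// mulr_ge0.
have : sqn (z - p) <= \sum_(k < d) 4.
  apply: ler_sum => k _; rewrite !mxE.
  by have := hz k; have := hp k; nra.
rewrite sumr_const card_ord -mulr_natr => h; apply: (le_trans h); lra.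
Qed.

(** Laplace's method: near [p] the integrand is at least a multiple of t1^N, away from [p] its
    negative part is at most a multiple of t2^N with t2 < t1, so the integral is positive for large
    N. *)
Lemma peak_pos g p : (forall z, cts g z) -> (forall k, -1 < p 0 k < 1) -> 0 < g p ->
  (forall N, box (fun z => (1 - peakc * sqn (z - p)) ^+ N * g z) = 0) -> False.
Proof.
move=> cg hp gp H; pose c := g p / 2.
have c0 : 0 < c by rewrite divr_gt0.
have : \forall z \near p, c < g z by apply: (cvgr_gt _ (cg p)); rewrite /c; lra.
move=> /nbhs_ballP[del /= del0 hdel].
pose r := Num.min del 1; have r0 : 0 < r by rewrite lt_min del0 ltr01.
have r1 : r ^+ 2 <= 1 by apply: exprn_ile1; [exact: ltW|rewrite /r ge_min lexx orbT].
have near z : sqn (z - p) < r ^+ 2 -> c < g z.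
  move=> zr; apply: hdel; split => // i k; rewrite (ord1 i).
  have := coord_lt_sqn k r0 zr; rewrite !mxE distrC => h.
  by apply: (lt_le_trans h); rewrite /r ge_min lexx.
have a0 := peakc_gt0; have a1 := peakc_lt1.
pose q z := 1 - peakc * sqn (z - p).
(* The values of the paraboloid at distance r/2 and r from [p]. In the shell between them the
   integrand is positive and is simply dropped. *)
pose t1 := 1 - peakc * (r ^+ 2 / 4); pose t2 := 1 - peakc * r ^+ 2.
have r20 : 0 < r ^+ 2 by rewrite exprn_gt0.
have ar : peakc * r ^+ 2 < 1.
  by apply: (le_lt_trans _ a1); rewrite ler_piMr// ltW.
have t20 : 0 < t2 by rewrite /t2; lra.
have t21 : t2 < t1.
  rewrite /t2 /t1; have : 0 < peakc * r ^+ 2 by rewrite mulr_gt0. lra.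
have t10 : 0 < t1 by lra.
(* A continuous substitute for the indicator of the ball of radius r/2. Its maximum is r^2/4, so
   that c' b <= c. *)
pose b z := pospow 1 (r ^+ 2 / 4 - sqn (z - p)).
have cq z : cts q z.
  by apply: ctsB; [exact: cts_cst|apply: ctsM; [exact: cts_cst|exact: sqnB_cts]].
have cb z : cts b z.
  apply: (@cts_comp _ _ _ (pospow 1) (fun z => r ^+ 2 / 4 - sqn (z - p))); first exact: pospow_cts.
  by apply: (@ctsB _ _ (fun=> r ^+ 2 / 4) (fun z => sqn (z - p))); [exact: cts_cst|exact: sqnB_cts].
have cn z : cts (fun z => `|g z|) z by exact: cvg_norm (cg z).
have cqg N z : cts (fun z => q z ^+ N * g z) z by apply: ctsM; [apply: ctsX; exact: cq|exact: cg].
have ca e z : cts (fun z => e * b z) z by apply: ctsM; [exact: cts_cst|exact: cb].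
have cc e z : cts (fun z => e * `|g z|) z by apply: ctsM; [exact: cts_cst|exact: cn].
pose c' := c / (r ^+ 2 / 4).
have c'0 : 0 < c' by rewrite !divr_gt0.
have pinb : inbox p by move=> k; have := hp k; lra.
have key N z : inbox z -> c' * t1 ^+ N * b z - t2 ^+ N * `|g z| <= q z ^+ N * g z.
  move=> hz; have q0 : 0 <= q z by exact: peak_ge0.
  have [zr|zr] := ltP (sqn (z - p)) (r ^+ 2).
    have gc := near z zr; have g0 : 0 < g z by lra.
    have h1 : 0 <= t2 ^+ N * `|g z| by rewrite mulr_ge0// exprn_ge0// ltW.
    suff : c' * t1 ^+ N * b z <= q z ^+ N * g z by lra.
    have [zr4|zr4] := ltP (sqn (z - p)) (r ^+ 2 / 4); last first.
      by rewrite /b pospow_npos ?subr_le0// mulr0; apply: mulr_ge0; [exact: exprn_ge0|exact: ltW].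
    have bl : c' * b z <= c.
      rewrite /b /pospow expr1 max_r; last by rewrite subr_ge0 ltW.
      rewrite /c' mulrAC ler_pdivrMr ?divr_gt0//; apply: ler_wpM2l; first exact: ltW.
      by have := sqn_ge0 (z - p); lra.
    have tq : t1 ^+ N <= q z ^+ N.
      apply: lerXn2r; rewrite ?nnegrE//; first exact: ltW.
      by rewrite /t1 /q lerB// ler_pM2l// ltW.
    rewrite mulrAC mulrC; apply: ler_pM => //.
    - by rewrite exprn_ge0// ltW.
    - by apply: mulr_ge0; [exact: ltW|exact: pospow_ge0].
    - by apply: (le_trans bl); exact: ltW.
  have -> : b z = 0 by rewrite /b pospow_npos//; lra.
  rewrite mulr0 sub0r.
  have qt : q z ^+ N <= t2 ^+ N.
    apply: lerXn2r; rewrite ?nnegrE//; first exact: ltW.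
    by rewrite /q /t2 lerB// ler_pM2l.
  have h1 : q z ^+ N * `|g z| <= t2 ^+ N * `|g z| by rewrite ler_wpM2r.
  have h2 : - `|g z| <= g z by rewrite lerNl -normrN ler_norm.
  have h3 : q z ^+ N * - `|g z| <= q z ^+ N * g z by rewrite ler_wpM2l// exprn_ge0.
  lra.
pose B := box b; pose G := box (fun z => `|g z|).
have B0 : 0 < B.
  apply: (@box_gt0 _ _ b p) => //; first by move=> z _; exact: pospow_ge0.
  rewrite /b subrr pospow_gt0// (_ : sqn 0 = 0) ?subr0 ?divr_gt0//.
  by rewrite /sqn big1// => k _; rewrite mxE expr0n.
have G0 : 0 <= G by apply: box_ge0.
have le N : c' * B <= (t2 / t1) ^+ N * G.
  have : box (fun z => c' * t1 ^+ N * b z - t2 ^+ N * `|g z|) <= 0.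
    rewrite -[leRHS](H N); apply: box_le => [z|z|z]; [|exact: (cqg N)|exact: key].
    exact: (@ctsB _ _ (fun z => c' * t1 ^+ N * b z) (fun z => t2 ^+ N * `|g z|) z (ca _ z) (cc _ z)).
  rewrite boxB// !boxZ// -/B -/G => h.
  rewrite expr_div_n [leRHS]mulrAC ler_pdivlMr ?exprn_gt0//; lra.
have := @cvg_expr R (t2 / t1).
rewrite ger0_norm ?divr_ge0 ?ltW// ltr_pdivrMr// mul1r t21 => /(_ isT) cv.
have cv2 : (t2 / t1) ^+ n * G @[n --> \oo] --> (0 * G : R).
  by apply: cvgMr_tmp.
have h : 0 * G < c' * B by rewrite mul0r mulr_gt0.
have [N hN] := filter_ex (cvgr_lt _ cv2 _ h).
by have := le N; rewrite leNgt hN.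
Qed.

Lemma peak g p : (forall z, cts g z) -> (forall k, -1 < p 0 k < 1) ->
  (forall N, box (fun z => (1 - peakc * sqn (z - p)) ^+ N * g z) = 0) -> g p = 0.
Proof.
move=> cg hp H; have [gp|gp|//] := ltgtP (g p) 0; exfalso.
  apply: (@peak_pos (fun z => - g z) p) => //.
  - by move=> z; exact: ctsN.
  - by rewrite oppr_gt0.
  - move=> N; rewrite (_ : (fun z => _) = fun z => -1 * ((1 - peakc * sqn (z - p)) ^+ N * g z)).
      rewrite boxZ ?H ?mulr0// => z; apply: ctsM => //; apply: ctsX.
      by apply: ctsB; [exact: cts_cst|apply: ctsM; [exact: cts_cst|exact: sqnB_cts]].
    by apply/funext => z; rewrite mulrN mulN1r.
exact: (@peak_pos g p).
Qed.

End Peak.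

(** * Vanishing on the double cone *)

Section Assembly.
Variables (R : realType) (d1 d2 : nat).
Implicit Types (x : 'rV[R]_d1) (y z : 'rV[R]_d2) (p : 'rV[R]_(d1 + d2)).

Lemma C2_C2dder (u : 'rV[R]_(d1 + d2) -> R) : C2 u -> C2dder u.
Proof.
move=> [cu hu]; split.
  split=> [p|i]; first exact: cu.
  by have [du [cdu _]] := hu i; split => p; [exact: derivable_dder|exact: cdu].
move=> i; have [_ [cdu hdu]] := hu i; split=> [p|j]; first exact: cdu.
by have [ddu cddu] := hdu j; split => p; [exact: derivable_dder|exact: cddu].
Qed.

Lemma sum_lt_split (F : 'I_(d1 + d2) -> R) : \sum_(k < d1 + d2 | (k < d1)%N) F k = \sum_i F (lshift d2 i).
Proof.
rewrite big_split_ord /= [X in _ + X]big_pred0 ?addr0; last first.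
  by move=> j /=; rewrite ltnNge leq_addr.
by apply: eq_bigl => i /=; rewrite ltn_ord.
Qed.

Lemma sum_ge_split (F : 'I_(d1 + d2) -> R) : \sum_(k < d1 + d2 | (d1 <= k)%N) F k = \sum_j F (rshift d1 j).
Proof.
rewrite big_split_ord /= [X in X + _]big_pred0 ?add0r; last first.
  by move=> j /=; rewrite leqNgt ltn_ord.
by apply: eq_bigl => i /=; rewrite leq_addr.
Qed.

Lemma sum_gt_split (F : 'I_(d1 + d2) -> R) (o : 'I_d2) : (o : nat) = 0%N ->
  \sum_(k < d1 + d2 | (d1 < k)%N) F k = \sum_(j | j != o) F (rshift d1 j).
Proof.
move=> o0; rewrite big_split_ord /= [X in X + _]big_pred0 ?add0r; last first.
  by move=> j /=; rewrite ltnNge ltnW// ltn_ord.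
apply: eq_bigl => i /=; rewrite -[X in (X < _)%N]addn0 ltn_add2l.
by rewrite -val_eqE /= o0 lt0n.
Qed.

Lemma sqxE x y : sqx (row_mx x y) = sqn x.
Proof. by rewrite /sqx sum_lt_split; apply: eq_bigr => i _; rewrite row_mxEl. Qed.

Lemma sqyE x y : sqy (row_mx x y) = sqn y.
Proof. by rewrite /sqy sum_ge_split; apply: eq_bigr => i _; rewrite row_mxEr. Qed.

Lemma sqy'E x y (o : 'I_d2) : (o : nat) = 0%N -> y 0 o = 0 -> sqy' (row_mx x y) = sqn y.
Proof.
move=> o0 yo; rewrite /sqy' (sum_gt_split _ o0) /sqn [in RHS](bigD1 o)//= yo expr0n add0r.
by apply: eq_bigr => i _; rewrite row_mxEr.
Qed.

Lemma on_y1_0E x y (o : 'I_d2) : (o : nat) = 0%N -> on_y1_0 (row_mx x y) <-> y 0 o = 0.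
Proof.
move=> o0; split=> [h|yo k kd].
  by have := h (rshift d1 o); rewrite row_mxEr; apply; rewrite /= o0 addn0.
have -> : k = rshift d1 o by apply/val_inj; rewrite /= o0 addn0.
by rewrite row_mxEr.
Qed.

Variables (u : 'rV[R]_(d1 + d2) -> R) (eps : R) (o : 'I_d2).
Hypotheses (o0 : (o : nat) = 0%N) (eps0 : 0 < eps).
Hypotheses (hu : C2 u) (hwave : forall p, wave_op u p = 0).
Hypothesis hdata : forall p, Zeps eps p ->
     u p = 0 /\ forall k : 'I_(d1 + d2), (k : nat) = d1 -> pderiv k u p = 0.

Let Cu : C2dder u. Proof. exact: C2_C2dder. Qed.
Let Cu1 : C1 u. Proof. exact: (proj1 Cu). Qed.
Let C1x i : C1 (dx i u). Proof. exact: (proj2 Cu). Qed.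
Let C1y j : C1 (dy j u). Proof. exact: (proj2 Cu). Qed.

Let wave p : \sum_i dx i (dx i u) p = \sum_j dy j (dy j u) p.
Proof.
have := hwave p; rewrite /wave_op sum_lt_split sum_ge_split => /eqP.
by rewrite subr_eq0 => /eqP.
Qed.

Let Z x y := y 0 o = 0 /\ sqn x + sqn y / eps ^+ 2 < 1.

Let Z_Zeps x y : Z x y -> Zeps eps (row_mx x y).
Proof.
move=> [yo h]; split; first exact/(on_y1_0E _ _ o0).
by rewrite sqxE (sqy'E _ o0).
Qed.

(** [Z] is open in the hyperplane, so a short segment in a tangential direction stays in it and
    carries the zero function. *)
Lemma dx_Z (f : 'rV[R]_(d1 + d2) -> R) i x y : C1 f -> (forall x y, Z x y -> f (row_mx x y) = 0) ->
  Z x y -> dx i f (row_mx x y) = 0.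
Proof.
move=> Cf f0 [yo hZ]; apply: (der_uniq (dder_x Cf x y i)).
apply: (@der_near _ (fun=> 0)); last exact: der_cst.
have csq : cts (fun t : R => sqn (x + t *: basisv R i) + sqn y / eps ^+ 2) 0.
  apply: ctsD; last exact: cts_cst.
  by apply: der_cts; exact: sqn_dder.
have : \forall t \near (0 : R), sqn (x + t *: basisv R i) + sqn y / eps ^+ 2 < 1.
  by apply: (cvgr_lt _ csq); rewrite scale0r addr0.
by apply: filterS => t ht; rewrite f0.
Qed.

Lemma dy_Z (f : 'rV[R]_(d1 + d2) -> R) j x y : C1 f -> (forall x y, Z x y -> f (row_mx x y) = 0) ->
  j != o -> Z x y -> dy j f (row_mx x y) = 0.
Proof.
move=> Cf f0 jo [yo hZ]; apply: (der_uniq (dder_yj Cf x y j)).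
apply: (@der_near _ (fun=> 0)); last exact: der_cst.
have csq : cts (fun t : R => sqn x + sqn (y + t *: basisv R j) / eps ^+ 2) 0.
  apply: ctsD; first exact: cts_cst.
  apply: ctsM; last exact: cts_cst.
  by apply: der_cts; exact: sqn_dder.
have : \forall t \near (0 : R), sqn x + sqn (y + t *: basisv R j) / eps ^+ 2 < 1.
  by apply: (cvgr_lt _ csq); rewrite scale0r addr0.
apply: filterS => t ht; rewrite f0//; split => //.
by rewrite /basisv !mxE (eq_sym o) (negbTE jo) andbF mulr0 addr0.
Qed.

Let u_Z x y : Z x y -> u (row_mx x y) = 0.
Proof. by move=> /Z_Zeps /hdata[]. Qed.

Let uy_Z j x y : Z x y -> dy j u (row_mx x y) = 0.
Proof.
have [->|jo] := eqVneq j o; last exact: dy_Z.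
by move=> /Z_Zeps /hdata[_]; apply; rewrite /= o0 addn0.
Qed.

Let ux_Z i x y : Z x y -> dx i u (row_mx x y) = 0.
Proof. exact: dx_Z. Qed.

Let uxo_Z i x y : Z x y -> dx i (dy o u) (row_mx x y) = 0.
Proof. by apply: dx_Z => //; exact: uy_Z. Qed.

(** For j = o the equation is used: every other second derivative in it is a tangential derivative
    of a function vanishing on [Z]. *)
Let uyo_Z j x y : Z x y -> dy j (dy o u) (row_mx x y) = 0.
Proof.
move=> hZ; have [->|jo] := eqVneq j o; last first.
  by apply: dy_Z => //; exact: uy_Z.
have := wave (row_mx x y); rewrite big1; last first.
  by move=> i _; apply: dx_Z => //; exact: ux_Z.
rewrite (bigD1 o)//= big1 ?addr0// => k ko.
by apply: dy_Z => //; exact: uy_Z.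
Qed.

(** The triangle inequality in squared form, from (p + q)^2 <= (a + r) (p^2 / a + q^2 / r)
    coordinate by coordinate. The number [a] is a positive upper bound of the norm, which allows x =
    0. *)
Lemma sqnD_lt n (x v : 'rV[R]_n) a r : 0 < a -> 0 < r -> sqn x <= a ^+ 2 -> sqn (v - x) < r ^+ 2 ->
  sqn v < (a + r) ^+ 2.
Proof.
move=> a0 r0 xa vr; have : sqn v <= (a + r) * (sqn x / a + sqn (v - x) / r).
  rewrite /sqn !mulr_suml -big_split mulr_sumr; apply: ler_sum => k _.
  rewrite !mxE -subr_ge0 /=.
  have -> : (a + r) * (x 0 k ^+ 2 / a + (v 0 k - x 0 k) ^+ 2 / r) - v 0 k ^+ 2 =
    (r * x 0 k - a * (v 0 k - x 0 k)) ^+ 2 / (a * r) by field; rewrite !gt_eqF.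
  by rewrite divr_ge0 ?sqr_ge0// mulr_ge0// ltW.
move=> h; apply: (le_lt_trans h); rewrite expr2 ltr_pM2l ?addr_gt0//.
apply: ler_ltD; first by rewrite ler_pdivrMr// -expr2.
by rewrite ltr_pdivrMr// -expr2.
Qed.

Lemma vanish_D x y : Num.sqrt (sqn x) + Num.sqrt (sqn y) < 1 -> u (row_mx x y) = 0.
Proof.
set a := Num.sqrt (sqn x); set b := Num.sqrt (sqn y) => ab.
have a0 : 0 <= a by exact: sqrtr_ge0.
have b0 : 0 <= b by exact: sqrtr_ge0.
have aE : sqn x = a ^+ 2 by rewrite sqr_sqrtr// sqn_ge0.
have bE : sqn y = b ^+ 2 by rewrite sqr_sqrtr// sqn_ge0.
(* The gap 4 del leaves one [del] to make a + del positive, one to put [rho] above |y|, and the rest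
   to keep t = a + b + 2 del below 1. *)
pose del := (1 - a - b) / 4; have del0 : 0 < del by rewrite divr_gt0//; lra.
have delE : 4 * del = 1 - a - b by rewrite /del; field.
pose rho := b + del; have rho0 : 0 < rho by rewrite /rho; lra.
pose t := (a + del) + rho; have t0 : 0 < t by rewrite /t; lra.
have t1 : t < 1 by rewrite /t /rho; lra.
have t2 : t ^+ 2 < 1 by rewrite expr_lt1// ltW.
(* Over the base of the cone |v| < t, so this bound on |w|^2 keeps (v, w) in Z_eps. *)
pose eta := eps ^+ 2 * (1 - t ^+ 2).
have e20 : 0 < eps ^+ 2 by rewrite exprn_gt0.
have eta0 : 0 < eta by rewrite mulr_gt0// subr_gt0.
have xt v : sqn (v - x) < rho ^+ 2 -> sqn v < t ^+ 2.
  by apply: sqnD_lt => //; [lra|rewrite aE; nra].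
have inside v : sqn (v - x) < rho ^+ 2 -> forall k, `|v 0 k| < 1.
  move=> /xt vt k; apply: coord_lt_sqn => //; rewrite expr1n; lra.
have inZ (v : 'rV[R]_d1) (w : 'rV[R]_d2) : sqn (v - x) < rho ^+ 2 -> w 0 o = 0 -> sqn w < eta -> Z v w.
  move=> /xt vt wo we; split => //.
  have : sqn w / eps ^+ 2 < 1 - t ^+ 2 by rewrite ltr_pdivrMr// mulrC.
  lra.
have n1 : null_means o x eta rho u.
  move=> m w s wo we s0 sr; have wZ v hv := inZ v w hv wo we.
  exact: (@mean_even R d1 d2 u Cu wave x w rho inside (fun v hv => u_Z (wZ v hv))
    (fun i v hv => ux_Z i (wZ v hv)) (fun i v hv => uy_Z i (wZ v hv))).
have n2 : null_means o x eta rho (fun p => p 0 (rshift d1 o) * u p).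
  move=> m w s wo we s0 sr; have wZ v hv := inZ v w hv wo we.
  rewrite mean_coord; [|exact: (proj1 Cu1)|by move=> z; exact: ker_cts].
  rewrite wo mul0r add0r (@mean_odd R d1 d2 u Cu wave x w rho inside
    (fun i v hv => uy_Z i (wZ v hv)) o
    (fun i v hv => uxo_Z i (wZ v hv)) (fun i v hv => uyo_Z i (wZ v hv)))//.
  by rewrite mulr0.
have nn : null2 o x eta rho u by split.
(* Strictly between |y| and [rho]: the vanishing of the means applies at [s], and y / s lies inside
   the unit ball, where the kernel is positive. *)
pose s := b + del / 2; have s0 : 0 < s by rewrite /s; lra.
have s0' : s != 0 by rewrite gt_eqF.
have sr : s < rho by rewrite /s /rho; lra.
pose zs := s^-1 *: y.
have yE : y = 0 + s *: zs by rewrite add0r scalerA mulfV// scale1r.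
have sqnZ c (z : 'rV[R]_d2) : sqn (c *: z) = c ^+ 2 * sqn z.
  by rewrite /sqn mulr_sumr; apply: eq_bigr => k _; rewrite mxE exprMn.
have zs1 : sqn zs < 1.
  rewrite sqnZ bE exprVn mulrC ltr_pdivrMr ?exprn_gt0// mul1r /s; nra.
have := @peak R d2 (fun z => u (row_mx x (0 + s *: z)) * ker 2 z) zs.
have cu := proj1 Cu1.
have cg z : cts (fun z => u (row_mx x (0 + s *: z)) * ker 2 z) z.
  by apply: mean_cts_z => // ?; exact: ker_cts.
have zsin k : -1 < zs 0 k < 1.
  by rewrite -ltr_norml; apply: coord_lt_sqn => //; rewrite expr1n.
have H N : box (fun z => (1 - peakc R d2 * sqn (z - zs)) ^+ N *
    (u (row_mx x (0 + s *: z)) * ker 2 z)) = 0.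
  (* Under y = s z the paraboloid with coefficient [peakc R d2 / s ^+ 2] peaked at [y] becomes the
     one with [peakc R d2] peaked at [zs]. The centre is 0 and the exponent index is m = 0, giving
     [ker 2]. *)
  have [_ nN _] := null2_paraboloidX (peakc R d2 / s ^+ 2) y N nn.
  have y0 : (0 : 'rV[R]_d2) 0 o = 0 by rewrite mxE.
  have sq0 : sqn (0 : 'rV[R]_d2) < eta.
    by rewrite /sqn big1// => i _; rewrite mxE expr0n.
  rewrite -[RHS](nN 0%N 0 s y0 sq0 s0 sr); congr box; apply/funext => z.
  rewrite /paraboloid row_mxKr mulrA; congr (_ ^+ _ * _ * _).
  rewrite [in RHS]yE !add0r -scalerBr sqnZ mulrA; congr (1 - _ * _).
  by field.
move=> /(_ cg zsin H) /eqP; rewrite -yE mulf_eq0 => /orP[/eqP//|].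
by rewrite gt_eqF// /ker pospow_gt0// subr_gt0.
Qed.

End Assembly.

Theorem theorem11 (R : realType) (d1 d2 : nat)
  (hd1 : (1 <= d1)%N) (hd2 : (2 <= d2)%N)
  (eps : R) (heps0 : 0 < eps) (heps1 : eps <= 1)
  (u : 'rV[R]_(d1 + d2) -> R)
  (hu : C2 u)
  (hwave : forall p, wave_op u p = 0)
  (hdata : forall p, Zeps eps p ->
     u p = 0 /\ forall k : 'I_(d1 + d2), (k : nat) = d1 -> pderiv k u p = 0) :
  (forall p, Ddom p -> u p = 0) /\
  (forall p, Dslice p ->
     u p = 0 /\ forall k : 'I_(d1 + d2), (k : nat) = d1 -> pderiv k u p = 0).
Proof.
pose o := Ordinal (ltnW hd2); have o0 : (o : nat) = 0%N by [].
have D p : Ddom p -> u p = 0.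
  rewrite -(hsubmxK p) /Ddom sqxE sqyE.
  exact: (vanish_D o0 heps0 hu hwave hdata).
split=> // p; rewrite -(hsubmxK p); set x := lsubmx p; set y := rsubmx p.
move=> [/(on_y1_0E _ _ o0) yo]; rewrite sqxE (sqy'E _ o0 yo) => xy.
split=> [|k kd]; first by apply: D; rewrite /Ddom sqxE sqyE.
have -> : k = rshift d1 o by apply/val_inj; rewrite /= kd addn0.
have Cu1 : C1 u by exact: (proj1 (C2_C2dder hu)).
(* The domain D is open, so [u] vanishes on a short segment in the y_1-direction through a point of
   the slice. *)
apply: (der_uniq (dder_yj Cu1 x y o)).
apply: (@der_near _ (fun=> 0)); last exact: der_cst.
have csq : cts (fun t : R => Num.sqrt (sqn x) + Num.sqrt (sqn (y + t *: basisv R o))) 0.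
  apply: ctsD; first exact: cts_cst.
  apply: (@cts_comp _ _ _ Num.sqrt (fun t : R => sqn (y + t *: basisv R o))).
    exact: sqrt_continuous.
  by apply: der_cts; exact: sqn_dder.
have : \forall t \near (0 : R),
    Num.sqrt (sqn x) + Num.sqrt (sqn (y + t *: basisv R o)) < 1.
  by apply: (cvgr_lt _ csq); rewrite scale0r addr0.
by apply: filterS => t ht; rewrite D// /Ddom sqxE sqyE.
Qed.
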